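(* Let $\alpha \in (0,1)$. The set of functions $f \in C^{\alpha}[0,1]$ with $\dim_{B}(f) = 2- \alpha$ and for which there exists $E \subseteq [0,1]$ (depending on $f$) such that $\dim_{\mathcal{H}}(E) = 0$ and $h_f(x_0)= \alpha$ for every $x_0 \in [0,1] \setminus E$ is strongly $\mathfrak{c}$-algebrable.
   Context: $C^{\alpha}[0,1]$ is the set of functions $f:[0,1]\to\mathbb{R}$ for which there is $C>0$ with $|f(x)-f(y)|\le C|x-y|^{\alpha}$ for all $x,y\in[0,1]$; it is an algebra under pointwise operations. $\dim_B(f)$ is the box dimension of the graph $\{(x,f(x)):x\in[0,1]\}\subseteq\mathbb{R}^2$: for a bounded set $A\subseteq\mathbb{R}^d$, $N_\delta(A)$ is the minimal number of cubes of size $\delta$ needed to cover $A$, and $\dim_B(A)=\lim_{\delta\to0^+}\frac{\log N_\delta(A)}{-\log\delta}$ when this limit exists (so $\dim_B(f)=2-\alpha$ includes the existence of the limit). $\dim_{\mathcal{H}}$ denotes Hausdorff dimension. Hölder exponent: let $f:[0,1]\to\mathbb{R}$ be locally bounded, $x_0\in[0,1]$ and $\beta\ge0$. We write $f\in C^{\beta}(x_0)$ if there exist a constant $C>0$ and a polynomial $P_{x_0}$ of degree at most $[\beta]$ (integer part), both depending on $x_0$, such that $|f(x)-P_{x_0}(x)|\le C|x-x_0|^{\beta}$ for every $x$ in a neighborhood of $x_0$ (in $[0,1]$). The Hölder exponent of $f$ at $x_0$ is $h_f(x_0)=\sup\{\beta\ge0 : f\in C^{\beta}(x_0)\}\in[0,+\infty]$.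 Strong algebrability: for a commutative algebra $\mathcal{A}$ and a cardinal $\kappa$, a subset $\mathcal{B}\subseteq\mathcal{A}$ is strongly $\kappa$-algebrable if there is a $\kappa$-generated free algebra contained in $\mathcal{B}\cup\{0\}$, i.e. there is a set $X\subseteq\mathcal{A}$ of cardinality $\kappa$ such that (1) the subalgebra generated by $X$ (all $P(x_1,\dots,x_n)$ with $x_1,\dots,x_n\in X$ and $P$ a real polynomial without constant term) is contained in $\mathcal{B}\cup\{0\}$, and (2) $X$ is free: for every polynomial $P$ without constant term and any distinct $x_1,\dots,x_n\in X$, $P(x_1,\dots,x_n)=0$ if and only if $P=0$. $\mathfrak{c}$ is the cardinality of $\mathbb{R}$. *)

(* Defs.v *)
From HB Require Import structures.
From mathcomp Require Import all_boot all_order all_algebra.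
From mathcomp Require Import all_classical all_reals all_analysis.
(* The notations of mpoly clash with those of MathComp-Analysis. *)
From mathcomp Require mpoly.
Import -(notations) mpoly.

Set Implicit Arguments.
Unset Strict Implicit.
Unset Printing Implicit Defensive.

Import Order.TTheory GRing.Theory Num.Theory.
Import numFieldNormedType.Exports.

Local Open Scope classical_set_scope.
Local Open Scope ring_scope.

Definition unit_itv (R : realType) : Type := set_type `[0 : R, 1]%classic.

HB.instance Definition _ (R : realType) := SubChoice.on (unit_itv R).
HB.instance Definition _ (R : realType) := PseudoMetric.on (unit_itv R).

Fact unit_itv0_subproof (R : realType) : (0 : R) \in `[0 : R, 1]%classic.
Proof. by rewrite inE /= in_itv /= lexx ler01. Qed.

HB.instance Definition _ (R : realType) :=
  isPointed.Build (unit_itv R) (exist _ 0 (unit_itv0_subproof R)).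

Section function_algebra.
Variables (T : pointedType) (R : realType).

Fact fct_scalerAl (k : R) (f g : T -> R) : k *: (f * g) = (k *: f) * g.
Proof. by apply/funext => t; exact: mulrA. Qed.

Fact fct_scalerAr (k : R) (f g : T -> R) : k *: (f * g) = f * (k *: g).
Proof. by apply/funext => t; exact: mulrCA. Qed.

HB.instance Definition _ :=
  GRing.Lmodule_isLalgebra.Build R (T -> R) fct_scalerAl.
HB.instance Definition _ :=
  GRing.Lalgebra_isAlgebra.Build R (T -> R) fct_scalerAr.

End function_algebra.

Section algebrability.
Variables (K : comNzRingType) (A : comAlgType K).

Definition eval_mpoly n (x : 'I_n -> A) (P : mpoly.mpoly n K) : A :=
  mpoly.mmap (in_alg A) x P.

Definition no_constant_term n (P : mpoly.mpoly n K) : Prop :=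
  mpoly.mcoeff mpoly.mnm0 P = 0.

(* Not necessarily unital. *)
Definition generated_subalgebra (X : set A) : set A :=
  [set a | exists n (x : 'I_n -> A) (P : mpoly.mpoly n K),
    [/\ forall i, X (x i), no_constant_term P & a = eval_mpoly x P]].

Definition free_generators (X : set A) : Prop :=
  forall n (P : mpoly.mpoly n K) (x : 'I_n -> A),
    no_constant_term P -> injective x -> (forall i, X (x i)) ->
    (eval_mpoly x P = 0 <-> P = 0).

(* C is a set whose cardinality is the cardinal kappa. The generators lie in B
   or are 0, so for B inside a subalgebra of A it makes no difference whether
   the ambient algebra is A or that subalgebra. *)
Definition strongly_algebrable T (C : set T) (B : set A) : Prop :=
  exists X : set A, [/\ (X #= C)%card,
    generated_subalgebra X `<=` B `|` [set 0] & free_generators X].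

End algebrability.

Definition holder (R : realType) (alpha : R) : set (unit_itv R -> R) :=
  [set f | exists2 C : R, 0 < C &
    forall x y, `|f x - f y| <= C * `|val x - val y| `^ alpha].

Definition holder_at (R : realType) (f : unit_itv R -> R) (x0 : unit_itv R)
    (beta : R) : Prop :=
  exists (C : R) (P : {poly R}), [/\ 0 < C, (size P <= (Num.truncn beta).+1)%N &
    \forall x \near x0, `|f x - P.[val x]| <= C * `|val x - val x0| `^ beta].

Definition holder_exponent (R : realType) (f : unit_itv R -> R)
    (x0 : unit_itv R) : \bar R :=
  ereal_sup [set beta%:E | beta in [set b : R | 0 <= b /\ holder_at f x0 b]].

Section box_dimension.
Variables (R : realType) (d : nat).

Definition cube (c : 'rV[R]_d) (delta : R) : set 'rV[R]_d :=
  [set y | forall j, c 0 j <= y 0 j <= c 0 j + delta].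

Definition cube_covered (A : set 'rV[R]_d) (delta : R) (n : nat) : Prop :=
  exists c : 'I_n -> 'rV[R]_d, A `<=` \bigcup_i cube (c i) delta.

(* For A bounded and delta > 0 the infimum is a minimum. *)
Definition covering_number (A : set 'rV[R]_d) (delta : R) : R :=
  inf [set n%:R | n in cube_covered A delta].

Definition has_box_dim (A : set 'rV[R]_d) (s : R) : Prop :=
  bounded_set A /\
  ln (covering_number A delta) / - ln delta @[delta --> 0^'+] --> s.

End box_dimension.

Definition graph (R : realType) (f : unit_itv R -> R) : set 'rV[R]_2 :=
  range (fun x => \row_(i < 2) if i == 0 then val x else f x).

Section hausdorff_dimension.
Variables (R : realType) (V : normedModType R).
Local Open Scope ereal_scope.

Definition diam (U : set V) : \bar R :=
  ereal_sup [set `|p.1 - p.2|%:E | p in U `*` U].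

(* The empty set has weight 0 for every s, and a singleton has weight 1 for
   s = 0, so that the measure for s = 0 is the counting measure. *)
Definition diam_weight (s : R) (U : set V) : \bar R :=
  if U == set0 then 0 else diam U `^ s.

Definition hausdorff_premeasure (s delta : R) (E : set V) : \bar R :=
  ereal_inf [set \sum_(0 <= k <oo) diam_weight s (U k) |
    U in [set U : (set V)^nat |
      E `<=` \bigcup_k U k /\ forall k, diam (U k) <= delta%:E]].

Definition hausdorff_measure (s : R) (E : set V) : \bar R :=
  ereal_sup [set hausdorff_premeasure s delta E |
    delta in [set delta : R | (0 < delta)%R]].

Definition hausdorff_dim (E : set V) : \bar R :=
  ereal_inf [set s%:E |
    s in [set s : R | (0 <= s)%R /\ hausdorff_measure s E = 0]].

End hausdorff_dimension.

(* Main.v *)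
(* A polynomial without constant term in the generators exp (c_r V), where the
   positive reals c_r are linearly independent over the rationals, is phi o V for
   an exponential sum phi with positive exponents. Unless phi = 0, Rolle's theorem
   shows that phi' has finitely many zeros, so away from finitely many level sets
   of V the function phi o V oscillates locally like V. It thus suffices that V
   be alpha-Hoelder, have exponent alpha at every point, have level sets of
   Hausdorff dimension 0, and oscillate enough for box dimension 2 - alpha.
   Sum the waves b^(-alpha k) T(b^k x) over the k in a set S of naturals, with T
   the distance to the nearest integer. If S omits all k from n to m n, then the
   partial sum up to n is affine on each of b^n intervals with slopes bounded
   below, and the remainder is of order b^(-alpha m n); so a level set is covered
   by b^n intervals of that length, and dimension 0 results if S has such gaps
   with m arbitrarily large. At the scales in a gap the graph needs too few
   boxes, so V uses S on the left half of [0, 1] and the complement of S on the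
   right half: at every scale one of the halves oscillates. *)

Require Import Defs.
From mathcomp Require Import all_boot all_order all_algebra.
From mathcomp Require Import all_classical all_reals all_analysis.
From mathcomp Require mpoly.
From mathcomp Require Import ring lra zify.
Import -(notations) mpoly.

Set Implicit Arguments.
Unset Strict Implicit.
Unset Printing Implicit Defensive.

Import Order.TTheory GRing.Theory Num.Theory.
Import numFieldNormedType.Exports.

Local Open Scope classical_set_scope.
Local Open Scope ring_scope.

(** * Lacunary sums of triangle waves *)

(** Infinite sums of nonnegative terms are defined below as suprema of partial sums. This turns a
    tail estimate into two-sided bounds, without any convergence argument. *)
Lemma sup_range_bounds (R : realType) (u e : nat -> R) :
  (forall n m, u m <= u n + e n) ->
  forall n, u n <= sup (range u) <= u n + e n.
Proof.
move=> ue n; apply/andP; split.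
  apply: ub_le_sup; last by exists n.
  by exists (u n + e n) => _ [m _ <-].
by apply: ge_sup; [exists (u n), n|move=> _ [m _ <-]].
Qed.

Section triangle_wave.
Variable R : realType.
Implicit Types x y : R.

Definition tri x : R := `|x - (Num.floor (x + 2^-1))%:~R|.

Lemma tri_ge0 x : 0 <= tri x. Proof. exact: normr_ge0. Qed.

Lemma tri_le_half x : tri x <= 2^-1.
Proof.
have := floor_le (x + 2^-1); have := lt_succ_floor (x + 2^-1).
by rewrite /tri intrD ler_norml => ? ?; apply/andP; split; lra.
Qed.

(** [Num.floor (x + 2^-1)] is a nearest integer to [x]: every other integer is at distance at least
    1/2, while [tri x] is at most 1/2. *)
Lemma tri_le_dist x (m : int) : tri x <= `|x - m%:~R|.
Proof.
have := tri_le_half x; rewrite /tri.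
have := floor_le (x + 2^-1); have := lt_succ_floor (x + 2^-1).
set k := Num.floor _ => k1 k2 k3.
have [km|mk|->//] := ltgtP k m.
  have {}km : k%:~R + 1 <= m%:~R :> R by rewrite -(intrD _ k 1) ler_int lezD1.
  rewrite intrD in k1; apply: le_trans k3 _.
  by rewrite ler_normr; apply/orP; right; lra.
have {}mk : m%:~R + 1 <= k%:~R :> R by rewrite -(intrD _ m 1) ler_int lezD1.
by apply: le_trans k3 _; rewrite ler_normr; apply/orP; left; lra.
Qed.

Lemma tri_nat n : tri n%:R = 0.
Proof.
apply/eqP; rewrite eq_le tri_ge0 andbT.
by have := tri_le_dist n%:R n; rewrite -pmulrn subrr normr0.
Qed.

Lemma tri_lipschitz x y : `|tri x - tri y| <= `|x - y|.
Proof.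
suff H u v : tri u <= `|u - v| + tri v.
  by rewrite ler_norml; have := H x y; have := H y x; rewrite (distrC y) => ? ?;
    apply/andP; split; lra.
by apply: le_trans (tri_le_dist u (Num.floor (v + 2^-1))) _; exact: ler_distD.
Qed.

Lemma tri_affine n x : n%:R / 2 <= x <= n.+1%:R / 2 ->
  tri x = if odd n then n.+1%:R / 2 - x else x - n%:R / 2.
Proof.
set m := n./2.
have nE : n%:R = (odd n)%:R + 2 * m%:R :> R.
  by rewrite -{1}(odd_double_half n) natrD -muln2 natrM mulrC.
rewrite -(addn1 n) natrD nE => /andP[].
(* No integer lies strictly between [m] and [m + 1]. This gives the lower bounds on [tri x]; the
   upper bounds compare [x] with one of these two integers. *)
have mk (k : int) : k%:~R <= m%:R :> R \/ m%:R + 1 <= k%:~R :> R.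
  have [km|mk] := lerP k m%:Z; first by left; rewrite [leRHS]pmulrn ler_int.
  by right; rewrite [m%:R]pmulrn -(intrD _ m 1) ler_int lezD1.
case: (odd n) => /= x1 x2; apply/eqP; rewrite eq_le; apply/andP; split.
- have := tri_le_dist x (m%:Z + 1).
  rewrite intrD -pmulrn /= distrC ger0_norm; lra.
- rewrite /tri ler_normr; set k := Num.floor _.
  by have [?|?] := mk k; apply/orP; [left|right]; lra.
- have := tri_le_dist x m; rewrite -pmulrn ger0_norm; lra.
- rewrite /tri ler_normr; set k := Num.floor _.
  by have [?|?] := mk k; apply/orP; [left|right]; lra.
Qed.

Lemma tri_nat_half n : tri (n%:R + 2^-1) = 2^-1.
Proof.
have nE : n.*2%:R = 2 * n%:R :> R by rewrite -muln2 natrM mulrC.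
rewrite (@tri_affine n.*2) ?odd_double -?(addn1 n.*2) ?natrD nE; first by field.
by apply/andP; split; lra.
Qed.

End triangle_wave.

Section lacunary.
Variables (R : realType) (h : nat) (q : R).
Local Notation b := (2 * h)%N.
Hypotheses (h_gt0 : (0 < h)%N) (q_gt0 : 0 < q) (q_lt1 : q < 1).
(* q stands for b^-alpha. The slope of the n-th wave is (b q)^n; ratio 3 makes it
   exceed twice the sum of the slopes of all earlier waves. *)
Hypothesis bq_ge3 : 3 <= b%:R * q.
Implicit Types (S : pred nat) (x y : R) (n j : nat).

Definition lac_part S n x : R :=
  \sum_(k < n | S k) q ^+ k * tri (b%:R ^+ k * x).

Definition lac S x : R := sup (range (lac_part S ^~ x)).

(* [0, 1] is made of the cells of generation n and index j < b^n. *)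
Definition in_cell n j x := j%:R <= b%:R ^+ n * x <= j.+1%:R.

Lemma lac_base_gt0 : 0 < b%:R :> R.
Proof. by rewrite ltr0n muln_gt0. Qed.

Lemma lac_partS S n x : lac_part S n.+1 x =
  lac_part S n x + (if S n then q ^+ n * tri (b%:R ^+ n * x) else 0).
Proof. by rewrite /lac_part big_mkcond big_ord_recr -big_mkcond. Qed.

Lemma lac_partS_bounds S n x :
  lac_part S n x <= lac_part S n.+1 x <= lac_part S n x + q ^+ n.
Proof.
have qn := exprn_ge0 n (ltW q_gt0).
rewrite lac_partS lerDl lerD2l; case: ifP => _; last by rewrite lexx.
rewrite mulr_ge0 ?tri_ge0//= ler_piMr//.
by apply: le_trans (tri_le_half _) _; lra.
Qed.

Lemma lac_part_le S n m x : (n <= m)%N -> lac_part S n x <= lac_part S m x.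
Proof.
move=> /subnK <-; elim: (m - n)%N => // k IHk.
by apply: le_trans IHk _; have /andP[] := lac_partS_bounds S (k + n) x.
Qed.

Lemma tail_ge0 n : 0 <= (1 - q)^-1 * q ^+ n.
Proof.
by apply: mulr_ge0; rewrite ?exprn_ge0 ?invr_ge0 ?subr_ge0 ?ltW.
Qed.

Lemma lac_part_tail S n m x :
  lac_part S m x <= lac_part S n x + (1 - q)^-1 * q ^+ n.
Proof.
have [mn|/ltnW nm] := leqP m n.
  apply: le_trans (lac_part_le S x mn) _; rewrite lerDl.
  exact: tail_ge0.
(* Adding the geometric tail makes the partial sums nonincreasing in the index: the tail drops by
   exactly [q ^+ k] at step [k], which bounds the new term. *)
suff: lac_part S m x + (1 - q)^-1 * q ^+ m <=
      lac_part S n x + (1 - q)^-1 * q ^+ n.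
  apply: le_trans; rewrite lerDl.
  exact: tail_ge0.
rewrite -(subnK nm); elim: (m - n)%N => // k IHk.
apply: le_trans IHk; rewrite addSn exprS.
have /andP[_] := lac_partS_bounds S (k + n) x.
set Q := q ^+ (k + n).
have -> : (1 - q)^-1 * (q * Q) = (1 - q)^-1 * Q - Q by field; rewrite subr_eq0 gt_eqF.
lra.
Qed.

Lemma lac_bounds S n x :
  lac_part S n x <= lac S x <= lac_part S n x + (1 - q)^-1 * q ^+ n.
Proof.
apply: (@sup_range_bounds _ (lac_part S ^~ x) (fun n => (1 - q)^-1 * q ^+ n)).
by move=> {}n m; exact: lac_part_tail.
Qed.

(** At a grid point of generation [n], all waves from index [n] on are evaluated at integers and
    vanish. *)
Lemma lac_grid S n j x : b%:R ^+ n * x = j%:R -> lac S x = lac_part S n x.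
Proof.
move=> xj; apply/eqP; rewrite eq_le; have /andP[-> _] := lac_bounds S n x.
rewrite andbT; apply: ge_sup; first by exists (lac_part S 0 x), 0%N.
move=> _ [m _ <-]; have [mn|/ltnW nm] := leqP m n; first exact: lac_part_le.
rewrite -(subnK nm); elim: (m - n)%N => // k; apply: le_trans.
rewrite addSn lac_partS [b%:R ^+ _]exprD -mulrA xj -natrX -natrM tri_nat mulr0.
by case: ifP; rewrite addr0.
Qed.

Lemma lac_part_lipschitz S n x y :
  `|lac_part S n x - lac_part S n y| <= (b%:R * q) ^+ n * `|x - y|.
Proof.
(* The constant is sharpened by 1 so that the induction closes: twice [(b q)^n] is at most
   [(b q)^(n+1)]. *)
apply: (@le_trans _ _ (((b%:R * q) ^+ n - 1) * `|x - y|)); last first.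
  by rewrite ler_wpM2r// gerBl.
elim: n => [|n IHn]; first by rewrite /lac_part !big_ord0 !subrr normr0 mul0r.
rewrite !lac_partS opprD addrACA; apply: le_trans (ler_normD _ _) _.
have q_ge0 := ltW q_gt0.
have bqn : 0 <= (b%:R * q) ^+ n by rewrite exprn_ge0// mulr_ge0.
have : `|(if S n then q ^+ n * tri (b%:R ^+ n * x) else 0) -
    (if S n then q ^+ n * tri (b%:R ^+ n * y) else 0)| <=
    (b%:R * q) ^+ n * `|x - y|.
  case: ifP => _; last by rewrite subrr normr0 mulr_ge0.
  rewrite -mulrBr normrM ger0_norm ?exprn_ge0//.
  rewrite exprMn [_ * q ^+ n]mulrC -mulrA.
  rewrite ler_wpM2l ?exprn_ge0//.
  apply: le_trans (tri_lipschitz _ _) _.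
  by rewrite -mulrBr normrM ger0_norm ?exprn_ge0.
move=> H; apply: le_trans (lerD IHn H) _.
rewrite -mulrDl ler_wpM2r// exprS.
have := ler_wpM2r bqn bq_ge3; lra.
Qed.

(** Lipschitz bound for the head, uniform bound for the tail. The index [n] stays free and is later
    matched to the size of [x - y]. *)
Lemma lac_modulus S n x y :
  `|lac S x - lac S y| <= (b%:R * q) ^+ n * `|x - y| + (1 - q)^-1 * q ^+ n.
Proof.
have := lac_part_lipschitz S n x y.
have := lac_bounds S n x; have := lac_bounds S n y; rewrite !ler_norml.
by move=> /andP[? ?] /andP[? ?] /andP[? ?]; apply/andP; split; lra.
Qed.

Lemma in_cell_parent n j x : in_cell n.+1 j x -> in_cell n (j %/ b) x.
Proof.
rewrite /in_cell exprS -mulrA => /andP[jx xj].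
have b0 : (0 < b)%N by rewrite muln_gt0.
rewrite -(ler_pM2l lac_base_gt0) -[X in _ && X](ler_pM2l lac_base_gt0) -!natrM.
apply/andP; split.
  by apply: le_trans jx; rewrite ler_nat mulnC leq_trunc_div.
by apply: le_trans xj _; rewrite ler_nat mulnC ltn_ceil.
Qed.

(** Induction on [n]: the earlier slopes add up to at most [((b q)^n - 1) / 2], and the wave of
    index [n], if present, has slope [(b q)^n] in absolute value. It therefore dominates, so the
    total slope cannot cancel, and ratio 3 reproduces the upper bound. *)
Lemma lac_part_affine S n j : exists s v,
  [/\ forall x, in_cell n j x -> lac_part S n x = v + s * x,
      `|s| <= ((b%:R * q) ^+ n - 1) / 2 &
      (exists2 i, (i < n)%N & S i) -> 2^-1 <= `|s|].
Proof.
elim: n j => [|n IHn] j.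
  exists 0, 0; split => [x _||[]//]; rewrite ?normr0.
    by rewrite /lac_part big_ord0 mul0r addr0.
  by rewrite expr0; lra.
have [s [v [sv s_le s_ge]]] := IHn (j %/ b)%N.
have bqn : 1 <= (b%:R * q) ^+ n by rewrite exprn_ege1// (le_trans _ bq_ge3)// ler1n.
have bqSn : 3 * (b%:R * q) ^+ n <= (b%:R * q) ^+ n.+1.
  by rewrite exprS ler_wpM2r// (le_trans _ bqn).
have [Sn|nSn] := boolP (S n); last first.
  exists s, v; split.
  - move=> x /in_cell_parent/sv <-.
    by rewrite lac_partS (negbTE nSn) addr0.
  - by apply: le_trans s_le _; lra.
  move=> [i]; rewrite ltnS leq_eqVlt => /orP[/eqP->|lin Si].
    by rewrite (negbTE nSn).
  by apply: s_ge; exists i.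
(* As [b = 2 h], the cell [j] of generation [n.+1] lies in the half-period number [m] of the wave of
   index [n]. *)
pose m := (j %/ h)%N.
have triE : exists e w, [/\ `|e| = 1 :> R & forall x, in_cell n.+1 j x ->
    tri (b%:R ^+ n * x) = w + e * (b%:R ^+ n * x)].
  have mx x : in_cell n.+1 j x -> m%:R / 2 <= b%:R ^+ n * x <= m.+1%:R / 2.
    rewrite /in_cell exprS -mulrA; set y := _ ^+ n * x => /andP[jy yj].
    have h0 : 0 < h%:R :> R by rewrite ltr0n.
    have mj : m%:R * h%:R <= j%:R :> R by rewrite -natrM ler_nat leq_trunc_div.
    have jm : j.+1%:R <= m.+1%:R * h%:R :> R by rewrite -natrM ler_nat ltn_ceil.
    have := le_trans mj jy; have := le_trans yj jm; rewrite natrM.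
    have -> : 2 * h%:R * y = (2 * y) * h%:R by ring.
    by rewrite !ler_pM2r// => ? ?; apply/andP; split; lra.
  exists (if odd m then -1 else 1), (if odd m then m.+1%:R / 2 else - (m%:R / 2)).
  split; first by case: ifP; rewrite ?normrN normr1.
  by move=> x /mx /tri_affine ->; case: ifP => _; lra.
have [e [w [e1 triE']]] := triE.
exists (s + e * (b%:R * q) ^+ n), (v + q ^+ n * w).
have norm_e : `|e * (b%:R * q) ^+ n| = (b%:R * q) ^+ n.
  by rewrite normrM e1 mul1r ger0_norm//; lra.
split.
- move=> x xj; rewrite lac_partS Sn sv ?in_cell_parent// triE'//.
  by rewrite exprMn; ring.
- by apply: le_trans (ler_normD _ _) _; rewrite norm_e; lra.
move=> _; rewrite addrC; have := lerB_normD (e * (b%:R * q) ^+ n) s.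
rewrite norm_e; lra.
Qed.

(* On a cell of generation n with n in S, the partial sum is affine and the
   n-th wave has its zeros at the end points and its maximum at the midpoint,
   where all later waves vanish. *)
Lemma lac_second_difference S n j (l := j%:R / b%:R ^+ n)
    (r := j.+1%:R / b%:R ^+ n) : S n ->
  lac S l + lac S r - 2 * lac S ((l + r) / 2) = - q ^+ n.
Proof.
move=> Sn; have bn0 : b%:R ^+ n != 0 :> R by rewrite expf_neq0 // gt_eqF ?lac_base_gt0.
have lE : b%:R ^+ n * l = j%:R by rewrite mulrC divfK.
have rE : b%:R ^+ n * r = j.+1%:R by rewrite mulrC divfK.
have mE : b%:R ^+ n * ((l + r) / 2) = j%:R + 2^-1.
  rewrite mulrA mulrDr lE rE -(addn1 j) natrD; lra.
have mE' : b%:R ^+ n.+1 * ((l + r) / 2) = (b * j + h)%:R.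
  by rewrite exprS -mulrA mE natrD !natrM; lra.
rewrite (lac_grid S lE) (lac_grid S rE) (lac_grid S mE') lac_partS Sn mE.
rewrite tri_nat_half.
have [s [v [sv _ _]]] := lac_part_affine S n j.
have jj : j%:R <= j.+1%:R :> R by rewrite ler_nat.
rewrite !sv /in_cell ?lE ?rE ?mE ?lexx ?jj//; first by lra.
by rewrite -(addn1 j) natrD; apply/andP; split; lra.
Qed.

(** If [lac S] were closer than [q ^+ n / 4] to [w] at both end points and at the midpoint, the
    second difference, with weights 1, 1, -2, would be smaller than [q ^+ n] in absolute value. *)
Lemma lac_oscillation S n j (w : R) : S n ->
  exists2 x, in_cell n j x & q ^+ n / 4 <= `|lac S x - w|.
Proof.
move=> Sn; have := lac_second_difference j Sn.
set l := j%:R / _; set r := j.+1%:R / _ => E.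
have bn0 : b%:R ^+ n != 0 :> R by rewrite expf_neq0 // gt_eqF ?lac_base_gt0.
have lE : b%:R ^+ n * l = j%:R by rewrite mulrC divfK.
have rE : b%:R ^+ n * r = j.+1%:R by rewrite mulrC divfK.
have jj : j%:R <= j.+1%:R :> R by rewrite ler_nat.
have mj : j%:R <= b%:R ^+ n * ((l + r) / 2) <= j.+1%:R.
  by rewrite mulrA mulrDr lE rE; apply/andP; split; lra.
have [?|w1] := leP (q ^+ n / 4) `|lac S l - w|.
  by exists l; rewrite // /in_cell lE lexx.
have [?|w2] := leP (q ^+ n / 4) `|lac S r - w|.
  by exists r; rewrite // /in_cell rE lexx jj.
have [?|w3] := leP (q ^+ n / 4) `|lac S ((l + r) / 2) - w|.
  by exists ((l + r) / 2).
move: w1 w2 w3; rewrite !ltr_norml => /andP[? ?] /andP[? ?] /andP[? ?].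
exfalso; lra.
Qed.

(** The partial sum does not change across the gap, so on the cell [lac S] is an affine function of
    slope at least 1/2 in absolute value, up to the tail from [n'] on. *)
Lemma lac_level_set S n n' j x y :
  (exists2 i, (i < n)%N & S i) -> (n <= n')%N ->
  (forall k, (n <= k < n')%N -> ~~ S k) ->
  in_cell n j x -> in_cell n j y -> lac S x = lac S y ->
  `|x - y| <= 2 * ((1 - q)^-1 * q ^+ n').
Proof.
move=> ex_i nn' gap xj yj xy.
have gapE z : lac_part S n' z = lac_part S n z.
  have : forall k, (n <= k < n')%N -> ~~ S k by [].
  rewrite -(subnK nn'); elim: (n' - n)%N => // d IHd gapd.
  rewrite addSn lac_partS ifN; last by apply: gapd; rewrite leq_addl addSn ltnS /=.
  by rewrite addr0 IHd// => k /andP[nk kd]; apply: gapd; rewrite nk addSn ltnW.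
have [s [v [sv _ /(_ ex_i) s_ge]]] := lac_part_affine S n j.
have := lac_bounds S n' x; have := lac_bounds S n' y.
rewrite !gapE xy !sv//; set e := _ * q ^+ n' => /andP[? ?] /andP[? ?].
have : `|s * (x - y)| <= e by rewrite ler_norml; apply/andP; split; lra.
rewrite normrM; have := ler_wpM2r (normr_ge0 (x - y)) s_ge; lra.
Qed.

End lacunary.

(** * Sets of Hausdorff dimension zero *)

Section small_covers.
Variable R : realType.
Implicit Types (E F : set R) (s e : R).

(** Vanishing of all Hausdorff measures of positive order, witnessed by finite covers with explicit
    diameter bounds [r]. A single [e] bounds both the diameters and the sum. *)
Definition small_covers E := forall s e, 0 < s -> 0 < e ->
  exists n (U : nat -> set R) (r : nat -> R),
    [/\ forall x, E x -> exists2 i, (i < n)%N & U i x,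
        forall i, (i < n)%N ->
          0 <= r i <= e /\ forall x y, U i x -> U i y -> `|x - y| <= r i &
        \sum_(i < n) r i `^ s <= e].

Lemma small_covers_sub E F : E `<=` F -> small_covers F -> small_covers E.
Proof.
move=> EF coverF s e s0 e0; have [n [U [r [FU diamU sumr]]]] := coverF s e s0 e0.
by exists n, U, r; split => // x /EF; exact: FU.
Qed.

Lemma small_coversU E F :
  small_covers E -> small_covers F -> small_covers (E `|` F).
Proof.
move=> coverE coverF s e s0 e0.
have e20 : 0 < e / 2 by rewrite divr_gt0.
have [m [U [r [EU diamU sumU]]]] := coverE s _ s0 e20.
have [n [V [t [FV diamV sumV]]]] := coverF s _ s0 e20.
exists (m + n)%N, (fun i => if (i < m)%N then U i else V (i - m)%N),
  (fun i => if (i < m)%N then r i else t (i - m)%N).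
split.
- move=> x [/EU[i im Ux]|/FV[i i_n Vx]].
    by exists i; rewrite ?im// ltn_addr.
  by exists (m + i)%N; rewrite ?ltn_add2l// ltnNge leq_addr addKn.
- move=> i imn; case: ifPn => im.
    have [/andP[-> re] ?] := diamU _ im; split => //=.
    by apply: le_trans re _; lra.
  rewrite -leqNgt in im.
  have [|/andP[-> te] ?] := diamV (i - m)%N; first by rewrite ltn_subLR.
  by split => //=; apply: le_trans te _; lra.
rewrite big_split_ord /=.
under eq_bigr do rewrite ltn_ord.
under [X in _ + X]eq_bigr do rewrite ltnNge leq_addr addKn.
by lra.
Qed.

Lemma small_covers_uniform E :
  (forall s e, 0 < s -> 0 < e -> exists n (U : nat -> set R) r,
    [/\ forall x, E x -> exists2 i, (i < n)%N & U i x,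
        0 <= r <= e, forall i x y, U i x -> U i y -> `|x - y| <= r &
        n%:R * r `^ s <= e]) -> small_covers E.
Proof.
move=> coverE s e s0 e0; have [n [U [r [EU re diamU sumr]]]] := coverE s e s0 e0.
exists n, U, (fun=> r); split => // [i _|]; first by split => // x y; exact: diamU.
by rewrite sumr_const card_ord -mulr_natl.
Qed.

Local Open Scope ereal_scope.

Lemma diam_le (U : set R) (r : R) :
  (forall x y, U x -> U y -> (`|x - y| <= r)%R) -> diam U <= r%:E.
Proof.
by move=> Ur; apply: ge_ereal_sup => _ [[x y] [/= Ux Uy] <-]; rewrite lee_fin Ur.
Qed.

Lemma diam_weight_le (U : set R) (s r : R) : (0 <= s)%R -> (0 <= r)%R ->
  (forall x y, U x -> U y -> (`|x - y| <= r)%R) ->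
  diam_weight s U <= (r `^ s)%:E.
Proof.
move=> s0 r0 Ur; rewrite /diam_weight; case: ifPn => [_|/set0P[x Ux]].
  by rewrite lee_fin powR_ge0.
have dU := diam_le Ur.
rewrite -poweR_EFin; apply: gt0_ler_poweR => //.
- rewrite in_itv /= leey andbT; apply: ereal_sup_ubound.
  by exists (x, x); rewrite //= subrr normr0.
- by rewrite in_itv /= leey lee_fin r0.
Qed.

Lemma diam_weight_ge0 (U : set R) (s : R) : 0 <= diam_weight s U.
Proof. by rewrite /diam_weight; case: ifP => // _; exact: poweR_ge0. Qed.

Lemma hausdorff_premeasure_small_covers E (s d e : R) :
  (0 < s)%R -> (0 < d)%R -> (0 < e)%R ->
  small_covers E -> hausdorff_premeasure s d E <= e%:E.
Proof.
move=> s0 d0 e0 coverE.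
have de0 : (0 < Num.min d e)%R by rewrite lt_min d0.
have [n [U [r [EU diamU sumU]]]] := coverE _ _ s0 de0.
(* The finite cover is padded to a sequence with empty sets, whose weight is 0. *)
pose V k := if (k < n)%N then U k else set0.
apply: (@le_trans _ _ (\sum_(0 <= k <oo) diam_weight s (V k))).
  apply: ereal_inf_lbound; exists V => //; split.
    by move=> x /EU[i i_n Ux]; exists i => //; rewrite /V i_n.
  move=> k; rewrite /V; case: ifPn => [kn|_].
    have [/andP[_ rde] Uk] := diamU _ kn.
    apply: le_trans (diam_le Uk) _.
    by rewrite lee_fin (le_trans rde)// ge_min lexx.
  by apply: le_trans (@diam_le _ 0%R _) _ => //; rewrite lee_fin ltW.
apply: lime_le; first by apply: is_cvg_nneseries => k _ _; exact: diam_weight_ge0.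
near=> m.
have nm : (n <= m)%N by near: m; exact: nbhs_infty_ge.
have Vn : \sum_(n <= k < m) diam_weight s (V k) = 0.
  rewrite big_nat big1// => k /andP[nk _].
  by rewrite /V ltnNge nk /= /diam_weight eqxx.
rewrite (@big_cat_nat _ _ _ n)//= Vn adde0 big_mkord.
apply: (@le_trans _ _ (\sum_(k < n) (r k `^ s)%:E)).
  apply: lee_sum => k _; have [/andP[r0 _] Uk] := diamU _ (ltn_ord k).
  by rewrite /V ltn_ord diam_weight_le// ltW.
by rewrite sumEFin lee_fin (le_trans sumU)// ge_min lexx orbT.
Unshelve. all: by end_near.
Qed.

Lemma hausdorff_measure_small_covers E (s : R) :
  (0 < s)%R -> small_covers E -> hausdorff_measure s E = 0.
Proof.
move=> s0 coverE; apply/eqP; rewrite eq_le; apply/andP; split.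
  apply: ge_ereal_sup => _ [d /= d0 <-]; apply/lee_addgt0Pr => e e0.
  by rewrite add0e hausdorff_premeasure_small_covers.
apply: le_trans (_ : hausdorff_premeasure s 1 E <= _).
  apply: le_ereal_inf_tmp => _ [U _ <-].
  by apply: nneseries_ge0 => k _ _; exact: diam_weight_ge0.
by apply: ereal_sup_ubound; exists 1%R => //=.
Qed.

Lemma hausdorff_dim_small_covers E : small_covers E -> hausdorff_dim E = 0.
Proof.
move=> coverE; apply/eqP; rewrite eq_le; apply/andP; split.
  apply/lee_addgt0Pr => s s0; rewrite add0e.
  apply: ereal_inf_lbound; exists s => //; split; first exact: ltW.
  exact: hausdorff_measure_small_covers.
by apply: le_ereal_inf_tmp => _ [s [s0 _] <-]; rewrite lee_fin.
Qed.

End small_covers.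

(* The blocks [2 ^ 2 ^ j, 2 ^ 2 ^ j.+1) lie alternately outside and inside. *)
Definition blocks : pred nat := fun k => odd (trunc_log 2 (trunc_log 2 k)).

(** The block starting at [K = 2 ^ 2 ^ j] reaches up to [K ^ 2], hence contains everything below
    [m * K] once [m <= K]. Taking [j = 2 m + c] makes [K] large enough and gives [j] the parity
    [c]. *)
Lemma blocks_gap (c : bool) (m : nat) : exists K, [/\ (0 < K)%N, (m <= K)%N &
  forall k, (K <= k < m * K)%N -> blocks k = c].
Proof.
pose j := (m.*2 + c)%N; pose K := (2 ^ (2 ^ j))%N.
have mK : (m <= K)%N.
  apply: leq_trans (ltnW (ltn_expl _ _)) => //.
  apply: leq_trans (ltnW (ltn_expl _ _)) => //.
  by rewrite /j -addnn -addnA leq_addr.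
have K0 : (0 < K)%N by rewrite expn_gt0.
exists K; split => // k /andP[Kk kmK].
have kKK : (k < 2 ^ (2 ^ j.+1))%N.
  rewrite expnS mul2n -addnn expnD; apply: leq_trans kmK _.
  by rewrite leq_mul2r mK orbT.
have k0 : (0 < k)%N by apply: leq_trans Kk.
rewrite /blocks (_ : trunc_log 2 (trunc_log 2 k) = j).
  by rewrite /j oddD odd_double addFb; case: (c).
apply: trunc_log_eq => //; rewrite trunc_log_max//=.
by rewrite -(@ltn_exp2l 2)// (leq_ltn_trans _ kKK)// trunc_logP.
Qed.

(** * Box dimension of graphs *)

Section box_dimension.
Variable R : realType.
Implicit Types (delta : R).

(** After taking logarithms, the constants [c] and [C] change the quotient by at most
    [M / - ln delta], which tends to 0 with [delta]. *)
Lemma has_box_dim_bounds d (A : set 'rV[R]_d) (s c C d0 : R) :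
  bounded_set A -> 0 < c -> 0 < d0 ->
  (forall delta, 0 < delta < d0 ->
    exists2 n, cube_covered A delta n & n%:R <= C * delta `^ (- s)) ->
  (forall delta n, 0 < delta < d0 -> cube_covered A delta n ->
    c * delta `^ (- s) <= n%:R) ->
  has_box_dim A s.
Proof.
move=> Abnd c0 d00 upper lower; split => //.
pose M := `|ln c| + `|ln C| + 1.
have M0 : 0 < M by rewrite ltr_wpDl// addr_ge0.
apply/cvgrPdist_le => e e0.
near=> delta.
have delta0 : 0 < delta by near: delta; exact: nbhs_right_gt.
have delta_d0 : delta < d0 by near: delta; exact: nbhs_right_lt.
have delta_e : delta < expR (- (M / e)).
  by near: delta; apply: nbhs_right_lt; exact: expR_gt0.
have delta1 : M / e <= - ln delta.
  rewrite -[M / e]opprK lerN2 -[leRHS]expRK ler_ln ?posrE ?expR_gt0//.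
  exact: ltW.
have dd0 : 0 < delta < d0 by rewrite delta0.
have L0 : 0 < - ln delta by apply: lt_le_trans delta1; rewrite divr_gt0.
have [n nA nC] := upper _ dd0.
have ds0 : 0 < delta `^ (- s) by rewrite powR_gt0.
have lo : c * delta `^ (- s) <= covering_number A delta.
  apply: lb_le_inf; first by exists n%:R, n.
  by move=> _ [m mA <-]; exact: lower.
have up : covering_number A delta <= C * delta `^ (- s).
  apply: le_trans nC; apply: ge_inf; last by exists n.
  by exists 0 => _ [m _ <-].
have C0 : 0 < C.
  have := lt_le_trans (mulr_gt0 c0 ds0) (le_trans lo up).
  by rewrite pmulr_lgt0.
have N0 := lt_le_trans (mulr_gt0 c0 ds0) lo.
have {}lo : ln c - s * ln delta <= ln (covering_number A delta).
  rewrite -mulNr -ln_powR -lnM ?posrE// ler_ln ?posrE//.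
  by rewrite mulr_gt0.
have {}up : ln (covering_number A delta) <= ln C - s * ln delta.
  rewrite -mulNr -ln_powR -lnM ?posrE// ler_ln ?posrE//.
  by rewrite mulr_gt0.
have -> : s - ln (covering_number A delta) / - ln delta =
    (- s * ln delta - ln (covering_number A delta)) / - ln delta.
  by field; rewrite -oppr_eq0 gt_eqF.
rewrite normrM normfV (gtr0_norm L0) ler_pdivrMr//.
apply: (@le_trans _ _ M); last by rewrite mulrC -ler_pdivrMr.
have := ler_norm (ln C); have := ler_norm (- ln c); rewrite normrN => ? ?.
have := normr_ge0 (ln C); have := normr_ge0 (ln c) => ? ?.
by rewrite /M ler_norml; apply/andP; split; lra.
Unshelve. all: by end_near.
Qed.

Definition itv_graph (F : R -> R) : set 'rV[R]_2 :=
  graph (fun x : unit_itv R => F (val x)).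

Lemma val_unit_itv (x : unit_itv R) : 0 <= val x <= 1.
Proof. by have := valP x; rewrite inE /= in_itv. Qed.

Lemma unit_itv_val (x : R) : 0 <= x <= 1 -> exists y : unit_itv R, val y = x.
Proof.
move=> x01; have xP : x \in `[0 : R, 1]%classic by rewrite inE /= in_itv.
by exists (SigSub xP).
Qed.

Lemma cube_graph (F : R -> R) (c : 'rV[R]_2) (delta : R) (x : R) :
  cube c delta (\row_(i < 2) if i == 0 then x else F x) <->
  c 0 0 <= x <= c 0 0 + delta /\ c 0 1 <= F x <= c 0 1 + delta.
Proof.
split=> [H|[H0 H1] j]; first by have := H 0; have := H 1; rewrite !mxE.
rewrite mxE; have [->//|->//] : j = 0 \/ j = 1.
by case: j => [[|[|//]] ?]; [left|right]; exact: val_inj.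
Qed.

Lemma graph_bounded (F : R -> R) (M : R) :
  (forall x, 0 <= x <= 1 -> `|F x| <= M) -> bounded_set (itv_graph F).
Proof.
move=> FM; exists (1 + `|M|); split; first exact: num_real.
move=> K MK _ [x _ <-] /=; rewrite /Num.norm /= mx_normrE.
apply: bigmax_le => [|[i j] _ /=].
  by apply: ltW; apply: le_lt_trans MK; rewrite addr_ge0.
rewrite mxE; apply: ltW; apply: le_lt_trans MK.
have /andP[x0 x1] := val_unit_itv x.
case: ifP => _; first by rewrite ger0_norm// (le_trans x1)// lerDl.
apply: le_trans (FM _ (val_unit_itv x)) _.
by apply: le_trans (ler_norm _) _; rewrite lerDr.
Qed.

(** About [1 / delta] columns of width [delta] are used. Over the column starting at [i * delta],
    the graph stays within [C * da] of its value there, so about [2 * C * da / delta] stacked cubes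
    suffice. *)
Lemma holder_graph_cover (F : R -> R) (alpha C delta : R) : 0 < C ->
  (forall x y, 0 <= x <= 1 -> 0 <= y <= 1 ->
    `|F x - F y| <= C * `|x - y| `^ alpha) ->
  0 < alpha < 1 -> 0 < delta < 1 ->
  exists2 n, cube_covered (itv_graph F) delta n &
    n%:R <= 2 * (2 * C + 1) * delta `^ (- (2 - alpha)).
Proof.
move=> C0 FC /andP[alpha0 alpha1] /andP[delta0 delta1].
pose da := delta `^ alpha.
have da0 : 0 < da by rewrite powR_gt0.
have da_delta : delta <= da.
  by apply: ger1_powR; rewrite ?delta0 /= ltW.
pose n := (Num.truncn delta^-1).+1.
pose m := (Num.truncn (2 * C * da / delta)).+1.
have dV0 : 0 <= delta^-1 by rewrite invr_ge0 ltW.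
have row0 : 0 <= 2 * C * da / delta.
  by rewrite divr_ge0 ?mulr_ge0 ?(ltW C0) ?(ltW da0) ?(ltW delta0).
exists (n * m)%N.
  (* The index [i] encodes the column [i %/ m] and the row [i %% m]. *)
  exists (fun i => \row_(k < 2) if k == 0 then (i %/ m)%:R * delta
    else F ((i %/ m)%:R * delta) - C * da + (i %% m)%:R * delta).
  move=> _ [x _ <-]; have /andP[x0 x1] := val_unit_itv x.
  pose i := Num.truncn (val x / delta).
  have x_delta0 : 0 <= val x / delta by rewrite divr_ge0 ?(ltW delta0).
  have /andP[ix xi] := truncn_itv x_delta0; rewrite -/i in ix xi.
  have {}ix : i%:R * delta <= val x by rewrite -ler_pdivlMr.
  have {}xi : val x < i.+1%:R * delta by rewrite -ltr_pdivrMr.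
  have i01 : 0 <= i%:R * delta <= 1.
    by rewrite mulr_ge0 ?(ltW delta0)//= (le_trans ix).
  have i_n : (i < n)%N.
    by rewrite ltnS; apply: le_truncn; rewrite -[leRHS]mul1r ler_wpM2r.
  have Fi : `|F (val x) - F (i%:R * delta)| <= C * da.
    apply: le_trans (FC _ _ (val_unit_itv x) i01) _.
    rewrite ler_wpM2l ?(ltW C0)//.
    apply: ge0_ler_powR; rewrite ?nnegrE ?(ltW alpha0)//.
      exact: ltW.
    by rewrite ger0_norm ?subr_ge0//; move: xi; rewrite -natr1; lra.
  move: Fi; rewrite ler_norml => /andP[Fi1 Fi2].
  pose y := F (val x) - F (i%:R * delta) + C * da.
  have y0 : 0 <= y / delta by rewrite divr_ge0 ?(ltW delta0)// /y; lra.
  pose j := Num.truncn (y / delta).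
  have /andP[jy yj] := truncn_itv y0; rewrite -/j in jy yj.
  have {}jy : j%:R * delta <= y by rewrite -ler_pdivlMr.
  have {}yj : y < j.+1%:R * delta by rewrite -ltr_pdivrMr.
  have jm : (j < m)%N.
    by rewrite ltnS; apply: le_truncn; rewrite ler_pM2r ?invr_gt0// /y; lra.
  have ijnm : (i * m + j < n * m)%N.
    apply: (@leq_trans (i.+1 * m)); first by rewrite mulSn addnC ltn_add2r.
    by rewrite leq_mul2r i_n orbT.
  exists (Ordinal ijnm) => //; apply/cube_graph; rewrite !mxE /=.
  rewrite divnMDl// divn_small// addn0 modnMDl modn_small//.
  rewrite /y in jy yj; rewrite -natr1 in xi; rewrite -natr1 in yj.
  rewrite /= in ix xi jy yj.
  by split; apply/andP; split; lra.
have nle : n%:R <= 2 * delta^-1.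
  have /andP[+ _] := truncn_itv dV0; rewrite /n -natr1.
  have : 1 <= delta^-1 by rewrite invf_ge1// ltW.
  lra.
have mle : m%:R <= (2 * C + 1) * (da / delta).
  have /andP[+ _] := truncn_itv row0; rewrite /m -natr1.
  have : 1 <= da / delta by rewrite ler_pdivlMr// mul1r.
  lra.
have -> : delta `^ (- (2 - alpha)) = delta^-1 * (da / delta).
  rewrite -powR_inv1 ?(ltW delta0)// mulrCA -powRD; last first.
    by rewrite (gt_eqF delta0) implybT.
  by rewrite -powRD ?(gt_eqF delta0) ?implybT//; congr (_ `^ _); lra.
rewrite natrM; apply: le_trans (ler_pM _ _ nle mle) _ => //.
by rewrite le_eqVlt; apply/orP; left; apply/eqP; ring.
Qed.

End box_dimension.

(** * Lower bounds on covering numbers from separated points *)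

Section separated_points.
Variable R : realType.

Lemma IVT_convex (V : R -> R) (x y t : R) : continuous V -> 0 <= t <= 1 ->
  exists z, Num.min x y <= z <= Num.max x y /\ V z = V x + (V y - V x) * t.
Proof.
suff H x' y' t' : continuous V -> 0 <= t' <= 1 -> x' <= y' ->
    exists z, x' <= z <= y' /\ V z = V x' + (V y' - V x') * t'.
  move=> cV t01; have [xy|/ltW yx] := leP x y; first exact: H.
  have t01' : 0 <= 1 - t <= 1 by move/andP: t01 => [? ?]; apply/andP; split; lra.
  have [z [zxy Vz]] := H y x (1 - t) cV t01' yx.
  by exists z; split => //; rewrite Vz; ring.
move=> cV /andP[t0 t1] xy.
have [|z zxy Vz] := @IVT R V x' y' (V x' + (V y' - V x') * t') xy
  (continuous_subspaceT cV).
  by have [?|?] := leP (V x') (V y'); apply/andP; split; nra.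
by exists z; move: zxy; rewrite in_itv.
Qed.

Lemma scale_exists (b : nat) (d : R) : (1 < b)%N -> 0 < d < 1 ->
  exists n, b%:R ^+ n * d < 1 <= b%:R ^+ n.+1 * d.
Proof.
move=> b1 /andP[d0 d1].
have : exists n, 1 <= b%:R ^+ n * d.
  exists (Num.truncn d^-1).+1; rewrite -ler_pdivrMr// mul1r.
  apply: le_trans (ltW (truncnS_gt _)) _.
  by rewrite -natrX ler_nat; exact/ltnW/ltn_expl.
move=> exn; case: (ex_minnP exn) => -[|n] n1 nmin.
  by move: n1; rewrite expr0 mul1r leNgt d1.
exists n; rewrite n1 andbT ltNge; apply/negP => /nmin.
by rewrite ltnn.
Qed.

Variable h : nat.
Local Notation b := (2 * h)%N.
Local Notation in_cell := (@in_cell R h).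

Lemma in_cell_convex n j x y z : in_cell n j x -> in_cell n j y ->
  Num.min x y <= z <= Num.max x y -> in_cell n j z.
Proof.
have bn : 0 <= b%:R ^+ n :> R by rewrite exprn_ge0.
move=> /andP[jx xj] /andP[jy yj] /andP[].
rewrite ge_min le_max => /orP zlo /orP zhi; apply/andP; split.
  by case: zlo => /(ler_wpM2l bn); apply: le_trans.
by case: zhi => /(ler_wpM2l bn)/le_trans; apply.
Qed.

(* The graph has L * M points at mutual distance larger than delta: M points in
   each of L cells of generation n, separated horizontally from cell to cell
   and vertically within a cell. *)
Lemma graph_cover_ge (F V : R -> R) (J : set R) (n a L M N : nat)
    (c w delta : R) :
  continuous V -> 0 < c -> b%:R ^+ n * delta < 1 ->
  (forall u, (u < L)%N -> exists x y,
     [/\ in_cell n (a + u.*2) x, in_cell n (a + u.*2) y &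
         w <= `|V x - V y|]) ->
  (forall u x, (u < L)%N -> in_cell n (a + u.*2) x -> J x) ->
  (forall x, J x -> 0 <= x <= 1) ->
  (forall x y, J x -> J y -> c * `|V x - V y| <= `|F x - F y|) ->
  M%:R <= c * w * b%:R ^+ n ->
  cube_covered (itv_graph F) delta N -> (L * M <= N)%N.
Proof.
move=> cV c0 bdelta osc cellJ J01 lowV Mle [ctr cover].
have bn : 0 <= b%:R ^+ n :> R by rewrite exprn_ge0.
(* By the intermediate value theorem [V] takes in the cell the values at fractions [i / M] of the
   way from [V x] to [V y]; distinct ones differ by at least [w / M]. *)
have H (u : 'I_L) : exists g : 'I_M -> R,
    (forall i, in_cell n (a + u.*2) (g i)) /\
    (forall i i', i != i' -> w <= M%:R * `|V (g i) - V (g i')|).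
  have [x [y [xu yu wxy]]] := osc u (ltn_ord u).
  have K (i : 'I_M) : exists z, Num.min x y <= z <= Num.max x y /\
      V z = V x + (V y - V x) * (i%:R / M%:R).
    apply: IVT_convex => //; rewrite divr_ge0//= ler_pdivrMr ?mul1r ?ler_nat.
      exact/ltnW/ltn_ord.
    by rewrite ltr0n; exact: leq_ltn_trans (ltn_ord i).
  have [g gP] := choice K; exists g; split=> [i|i i' ii'].
    by have [gxy _] := gP i; exact: in_cell_convex gxy.
  have M0 : 0 < M%:R :> R by rewrite ltr0n; exact: leq_ltn_trans (ltn_ord i).
  have [_ ->] := gP i; have [_ ->] := gP i'.
  have -> : V x + (V y - V x) * (i%:R / M%:R) -
    (V x + (V y - V x) * (i'%:R / M%:R)) =
    (V y - V x) * ((i%:R - i'%:R) / M%:R) by ring.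
  rewrite !normrM normfV (ger0_norm (ltW M0)).
  have -> : M%:R * (`|V y - V x| * (`|i%:R - i'%:R| / M%:R)) =
      `|V y - V x| * `|i%:R - i'%:R| by field; rewrite gt_eqF.
  rewrite distrC; apply: le_trans wxy _.
  rewrite ler_peMr// (_ : i%:R - i'%:R = (i%:Z - i'%:Z)%:~R :> R).
    by apply: norm_intr_ge1; rewrite ?intr_int// intr_eq0 subr_eq0 eqz_nat.
  by rewrite intrB -!pmulrn.
have [G GP] := choice H.
have cov (p : 'I_L * 'I_M) : exists k : 'I_N,
    cube (ctr k) delta (\row_(i < 2) if i == 0 then G p.1 p.2 else F (G p.1 p.2)).
  have [Gp _] := GP p.1.
  have /unit_itv_val[x xE] := J01 _ (cellJ _ _ (ltn_ord p.1) (Gp p.2)).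
  have [|k _ kP] := cover (\row_(i < 2) if i == 0 then val x else F (val x)).
    by exists x.
  by exists k; rewrite -xE.
have [K KP] := choice cov.
have K_inj : injective K.
  move=> [u i] [u' i'] KK.
  have /cube_graph[/= /andP[x1 x2] /andP[y1 y2]] := KP (u, i).
  have := KP (u', i'); rewrite -KK.
  move=> /cube_graph[/= /andP[x1' x2'] /andP[y1' y2']].
  have dz : `|G u i - G u' i'| <= delta.
    by rewrite ler_norml; apply/andP; split; lra.
  have dF : `|F (G u i) - F (G u' i')| <= delta.
    by rewrite ler_norml; apply/andP; split; lra.
  have [Gu sep] := GP u; have [Gu' _] := GP u'.
  (* Only every other cell is used, so two different ones are separated by a whole cell, which is
     wider than [delta]. *)
  have far (v v' : 'I_L) (z z' : R) : in_cell n (a + v.*2) z ->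
      in_cell n (a + v'.*2) z' -> `|z - z'| <= delta -> (v < v')%N -> False.
    move=> /andP[_ zv] /andP[zv' _] zz vv'.
    have : ((a + v.*2).+1 + 1 <= a + v'.*2)%N.
      by rewrite addn1 -!addnS -doubleS leq_add2l leq_double.
    rewrite -(ler_nat R) natrD.
    have := ler_wpM2l bn zz; have := ler_norm (z' - z); rewrite distrC.
    move=> /(ler_wpM2l bn); rewrite mulrBr; lra.
  have uu' : u = u'.
    apply/val_inj; have [uu'|uu'|//] := ltngtP (val u) (val u').
      by have := far _ _ _ _ (Gu i) (Gu' i') dz uu'.
    by rewrite distrC in dz; have := far _ _ _ _ (Gu' i') (Gu i) dz uu'.
  (* Two points of one cell in the same cube would give [c * w <= M * delta], hence
     [M <= M * delta * b ^ n], contradicting [b ^ n * delta < 1]. *)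
  subst u'; congr (_, _); apply/eqP/negPn/negP => ii'.
  have M0 : 0 < M%:R :> R by rewrite ltr0n; exact: leq_ltn_trans (ltn_ord i).
  have := sep _ _ ii'; have := lowV _ _ (cellJ _ _ (ltn_ord u) (Gu i))
    (cellJ _ _ (ltn_ord u) (Gu i')).
  move=> /le_trans/(_ dF) cV_delta wM.
  have := ler_wpM2l (ltW c0) wM; rewrite mulrCA => /le_trans.
  move=> /(_ _ (ler_wpM2l (ltW M0) cV_delta)) cw.
  have := ler_wpM2r bn cw; move=> /(le_trans Mle).
  rewrite -mulrA leNgt -[ltRHS]mulr1 ltr_pM2l// mulrC => /negP; exact.
by have := leq_card K K_inj; rewrite card_prod !card_ord.
Qed.

End separated_points.

(** * The base function *)

Lemma geometric_small (R : realType) (A x e : R) : 0 <= x < 1 -> 0 < e ->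
  exists M, forall m, (M <= m)%N -> A * x ^+ m <= e.
Proof.
move=> /andP[x0 x1] e0.
have A1 : 0 < `|A| + 1 by rewrite ltr_wpDl.
have /cvgr0Pnorm_le/(_ _ (divr_gt0 e0 A1))[M _ xM] : x ^+ n @[n --> \oo] --> 0.
  by apply: cvg_expr; rewrite ger0_norm.
exists M => m /xM /=; rewrite ger0_norm ?exprn_ge0// ler_pdivlMr// => xme.
apply: le_trans xme; rewrite mulrC ler_wpM2l ?exprn_ge0//.
by have := ler_norm A; lra.
Qed.

Lemma dist_min_le (R : realDomainType) (a x y : R) :
  `|Num.min x a - Num.min y a| <= `|x - y|.
Proof.
suff H u v : u <= v -> `|Num.min u a - Num.min v a| <= `|u - v|.
  have [xy|/ltW yx] := leP x y; first exact: H.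
  by rewrite distrC (distrC x) H.
move=> uv; rewrite (ler0_norm (_ : u - v <= 0)) ?subr_le0// ler_norml.
by have [|] := leP u a; have [|] := leP v a => ? ?; apply/andP; split; lra.
Qed.

Lemma dist_max_le (R : realDomainType) (a x y : R) :
  `|Num.max x a - Num.max y a| <= `|x - y|.
Proof.
suff H u v : u <= v -> `|Num.max u a - Num.max v a| <= `|u - v|.
  have [xy|/ltW yx] := leP x y; first exact: H.
  by rewrite distrC (distrC x) H.
move=> uv; rewrite (ler0_norm (_ : u - v <= 0)) ?subr_le0// ler_norml.
by have [|] := leP u a; have [|] := leP v a => ? ?; apply/andP; split; lra.
Qed.

Section glued.
Variables (R : realType) (h : nat) (q : R).
Local Notation b := (2 * h)%N.
Hypotheses (h_gt0 : (0 < h)%N) (q_gt0 : 0 < q) (q_lt1 : q < 1).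
Hypothesis bq_ge3 : 3 <= b%:R * q.
Implicit Types (S : pred nat) (x y z : R) (n j : nat).
Local Notation lac := (lac h q).
Local Notation in_cell := (@in_cell R h).

Lemma cell_existence n x : 0 <= x <= 1 -> exists j, [/\ (j < b ^ n)%N,
  in_cell n j x & x < 1 -> (j%:R <= b%:R ^+ n * x < j.+1%:R)].
Proof.
move=> /andP[x0 x1]; have b0 := @lac_base_gt0 R h h_gt0.
have bn : 0 < b%:R ^+ n :> R by rewrite exprn_gt0.
(* The point 1 belongs to the last cell as its right end point; this is why the half-open condition
   is claimed only for [x < 1]. *)
have [x1'|x1'] := leP 1 x.
  have xE : x = 1 by apply/eqP; rewrite eq_le x1.
  have bN : (0 < b ^ n)%N by rewrite expn_gt0 muln_gt0 h_gt0.
  exists (b ^ n).-1; split; rewrite ?ltn_predL//.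
  rewrite /in_cell prednK// xE mulr1 natrX lexx andbT.
  by rewrite -natrX ler_nat leq_pred.
have nx : 0 <= b%:R ^+ n * x by rewrite mulr_ge0 // ltW.
have jx := truncn_itv nx.
exists (Num.truncn (b%:R ^+ n * x)); split => //.
  by rewrite truncn_lt_nat// natrX gtr_pMr.
by move/andP: jx => [? ?]; apply/andP; split => //; exact: ltW.
Qed.

Lemma dist_in_cell n j x y : in_cell n j x -> in_cell n j y ->
  b%:R ^+ n * `|x - y| <= 1.
Proof.
rewrite /in_cell -(natr1 j) => /andP[? ?] /andP[? ?].
have b0 := @lac_base_gt0 R h h_gt0.
rewrite -(ger0_norm (ltW (exprn_gt0 n b0))) -normrM mulrBr ler_norml.
by apply/andP; split; lra.
Qed.

(** With a gap from [K] to [m * K], one set per cell of generation [K] and per value in [Z] covers,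
    with diameters at most [C * q ^+ (m * K)]. The sum of their powers is
    [(size Z) * C^s * (b * t^m)^K] with [t = q^s]: first [m] makes the base at most 1/2, then
    [K >= m] makes the sum small. *)
Lemma lac_small_covers S (Z : seq R) : (exists i, S i) ->
  (forall m, exists K, [/\ (0 < K)%N, (m <= K)%N &
    forall k, (K <= k < m * K)%N -> ~~ S k]) ->
  small_covers [set x | 0 <= x <= 1 /\ lac S x \in Z].
Proof.
move=> [i0 Si0] gaps; apply: small_covers_uniform => s e s0 e0.
have b0 := @lac_base_gt0 R h h_gt0; have q0 := ltW q_gt0.
pose C : R := 2 * (1 - q)^-1.
have C0 : 0 < C by rewrite mulr_gt0// invr_gt0 subr_gt0.
pose t := q `^ s.
have t01 : 0 <= t < 1.
  have <- : 1 `^ s = 1 :> R by rewrite powR1.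
  rewrite powR_ge0 /=.
  by apply: gt0_ltr_powR; rewrite ?nnegrE.
have q01 : 0 <= q < 1 by rewrite q0.
have half_gt0 : 0 < 2^-1 :> R by rewrite invr_gt0.
have half01 : 0 <= (2^-1 : R) < 1 by rewrite invr_ge0 ler0n invf_lt1// ltr1n.
(* In turn: the base is at most 1/2, the sum of powers is at most [e], and the diameters are at most
   [e]. The later condition [i0 < m] puts a wave of [S] before generation [K], so that slopes are
   bounded below. *)
have [m1 H1] := @geometric_small R b%:R t 2^-1 t01 half_gt0.
have [m2 H2] := @geometric_small R ((size Z)%:R * C `^ s) 2^-1 e half01 e0.
have [m3 H3] := @geometric_small R C q e q01 e0.
have [m [m1m m2m m3m i0m]] : exists m,
    [/\ (m1 <= m)%N, (m2 <= m)%N, (m3 <= m)%N & (i0 < m)%N].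
  by exists (m1 + m2 + m3 + i0).+1; clear; split; lia.
have m_gt0 : (0 < m)%N by exact: leq_ltn_trans i0m.
have [K [K0 mK gapK]] := gaps m.
have KmK : (K <= m * K)%N by rewrite leq_pmull.
have mmK : (m <= m * K)%N by rewrite leq_pmulr.
exists (size Z * b ^ K)%N, (fun i => [set x | in_cell K (i %% b ^ K) x /\
  lac S x = nth 0 Z (i %/ b ^ K)]), (C * q ^+ (m * K)).
have bK0 : (0 < b ^ K)%N by rewrite expn_gt0 muln_gt0 h_gt0.
split.
- move=> x [/= x01 xZ]; have [j [jb xj _]] := @cell_existence K x x01.
  exists (index (lac S x) Z * b ^ K + j)%N.
    apply: (@leq_trans ((index (lac S x) Z).+1 * b ^ K)).
      by rewrite mulSn addnC ltn_add2r.
    by rewrite leq_mul2r index_mem xZ orbT.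
  by rewrite modnMDl modn_small// divnMDl// divn_small// addn0 nth_index.
- rewrite mulr_ge0 ?exprn_ge0 ?(ltW C0)//=.
  by apply: H3; exact: leq_trans mmK.
- move=> i x y [/= xi xZ] [/= yi yZ]; rewrite /C -mulrA.
  apply: (@lac_level_set R h q h_gt0 q_gt0 q_lt1 bq_ge3 S K (m * K)) xi yi _ => //.
    by exists i0 => //; exact: leq_trans mK.
  by rewrite xZ yZ.
have rs : (C * q ^+ (m * K)) `^ s = C `^ s * (t ^+ m) ^+ K.
  rewrite powRM ?exprn_ge0 ?(ltW C0)//; congr (_ * _).
  by rewrite -powR_mulrn// -powRrM mulrC powRrM powR_mulrn ?powR_ge0// exprM.
have -> : (size Z * b ^ K)%:R * (C * q ^+ (m * K)) `^ s =
    (size Z)%:R * C `^ s * (b%:R * t ^+ m) ^+ K.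
  by rewrite rs natrM natrX exprMn; ring.
apply: (@le_trans _ _ ((size Z)%:R * C `^ s * 2^-1 ^+ K)).
  rewrite ler_wpM2l ?mulr_ge0 ?powR_ge0//.
  apply: lerXn2r; rewrite ?nnegrE ?invr_ge0//; last exact: H1.
  by rewrite mulr_ge0 ?exprn_ge0 ?powR_ge0.
by apply: H2; exact: leq_trans mK.
Qed.

(* The two halves of [0, 1] carry complementary frequencies: every frequency is
   present in one half, and each half omits long blocks of frequencies. *)
Definition glued x : R :=
  lac blocks (Num.min x 2^-1) + lac (predC blocks) (Num.max x 2^-1).

Lemma glued_left x : x <= 2^-1 ->
  glued x = lac blocks x + lac (predC blocks) 2^-1.
Proof. by move=> x2; rewrite /glued min_l// max_r. Qed.

Lemma glued_right x : 2^-1 <= x ->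
  glued x = lac (predC blocks) x + lac blocks 2^-1.
Proof. by move=> x2; rewrite /glued min_r// max_l// addrC. Qed.

Lemma glued_modulus n x y : `|glued x - glued y| <=
  2 * ((b%:R * q) ^+ n * `|x - y| + (1 - q)^-1 * q ^+ n).
Proof.
have bqn : 0 <= (b%:R * q) ^+ n.
  by rewrite exprn_ge0// (le_trans _ bq_ge3).
have Hmin := lac_modulus q_gt0 q_lt1 bq_ge3 blocks n
  (Num.min x 2^-1) (Num.min y 2^-1).
have Hmax := lac_modulus q_gt0 q_lt1 bq_ge3 (predC blocks) n
  (Num.max x 2^-1) (Num.max y 2^-1).
have := ler_wpM2l bqn (dist_min_le 2^-1 x y).
have := ler_wpM2l bqn (dist_max_le 2^-1 x y).
rewrite /glued opprD addrACA => ? ?; apply: le_trans (ler_normD _ _) _; lra.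
Qed.

(** Since [b] is even, 1/2 is a grid point of every generation [n.+1], so each cell lies in one of
    the two halves. *)
Lemma half_grid n : b%:R ^+ n.+1 * 2^-1 = (h * b ^ n)%:R :> R.
Proof. by rewrite exprS [(h * _)%:R]natrM natrX !natrM; field. Qed.

Lemma glued_cell_left n j x : (j < h * b ^ n)%N -> in_cell n.+1 j x ->
  x <= 2^-1.
Proof.
move=> jn /andP[_ xj]; have b0 := @lac_base_gt0 R h h_gt0.
have bn : 0 < b%:R ^+ n.+1 :> R by rewrite exprn_gt0.
rewrite -(ler_pM2l bn) half_grid; apply: le_trans xj _.
by rewrite ler_nat.
Qed.

Lemma glued_cell_right n j x : (h * b ^ n <= j)%N -> in_cell n.+1 j x ->
  2^-1 <= x.
Proof.
move=> jn /andP[xj _]; have b0 := @lac_base_gt0 R h h_gt0.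
have bn : 0 < b%:R ^+ n.+1 :> R by rewrite exprn_gt0.
rewrite -(ler_pM2l bn) half_grid; apply: le_trans xj.
by rewrite ler_nat.
Qed.

(** The hypothesis says that the half containing the cell is the one carrying the frequency
    [n.+1]. *)
Lemma glued_oscillation n j (w : R) : (j < h * b ^ n)%N = blocks n.+1 ->
  exists2 x, in_cell n.+1 j x & q ^+ n.+1 / 4 <= `|glued x - w|.
Proof.
have [jn nblocks|jn nblocks] := ltnP.
  have [x xj osc] := lac_oscillation h_gt0 q_gt0 q_lt1 bq_ge3 j
    (w - lac (predC blocks) 2^-1) (esym nblocks).
  exists x => //; rewrite glued_left ?(glued_cell_left jn)//.
  by rewrite opprB addrA in osc.
have Sn : predC blocks n.+1 by rewrite /= -nblocks.
have [x xj osc] := lac_oscillation h_gt0 q_gt0 q_lt1 bq_ge3 j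
  (w - lac blocks 2^-1) Sn.
exists x => //; rewrite glued_right ?(glued_cell_right jn)//.
by rewrite opprB addrA in osc.
Qed.

Lemma glued_cell n x : 0 <= x <= 1 -> exists j, [/\ (j < b ^ n.+1)%N,
  in_cell n.+1 j x & (j < h * b ^ n)%N = (x < 2^-1)].
Proof.
move=> x01; have [j [jb xj x1]] := cell_existence n.+1 x01; exists j; split => //.
have b0 := @lac_base_gt0 R h h_gt0.
have bn : 0 < b%:R ^+ n.+1 :> R by rewrite exprn_gt0.
have [jn|jn] := ltnP; apply/esym.
  have [|x1'] := ltP x 1; last first.
    have := glued_cell_left jn xj; lra.
  move=> /x1/andP[_ xjn]; rewrite -(ltr_pM2l bn) half_grid.
  by apply: lt_le_trans xjn _; rewrite ler_nat.
by apply/negbTE; rewrite -leNgt (glued_cell_right jn xj).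
Qed.

Lemma blocks_infinite (c : bool) N : exists2 n, (N <= n)%N & blocks n.+1 = c.
Proof.
have [K [K0 NK blocksK]] := blocks_gap c N.+2.
exists K.-1; first by rewrite -ltnS prednK//; exact: ltn_trans NK.
by rewrite prednK//; apply: blocksK; rewrite leqnn ltn_Pmull.
Qed.

Lemma in_cell_itv n j x : (j < b ^ n)%N -> in_cell n j x -> 0 <= x <= 1.
Proof.
move=> jb /andP[xj jx]; have b0 := @lac_base_gt0 R h h_gt0.
have bn : 0 < b%:R ^+ n :> R by rewrite exprn_gt0.
rewrite -(pmulr_rge0 _ bn) (le_trans _ xj)//= -(ler_pM2l bn) mulr1.
by apply: le_trans jx _; rewrite -natrX ler_nat.
Qed.

(** Each half carries infinitely many frequencies. Oscillation at infinitely many scales, rather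
    than at all of them, is enough to bound the exponent from above. *)
Lemma glued_pointwise_oscillation x N : 0 <= x <= 1 ->
  exists n y, [/\ (N <= n)%N, 0 <= y <= 1, b%:R ^+ n * `|y - x| <= 1 &
    q ^+ n / 4 <= `|glued y - glued x|].
Proof.
move=> x01; have [n Nn blocksn] := blocks_infinite (x < 2^-1) N.
have [j [jb xj jn]] := glued_cell n x01.
have [y yj osc] := glued_oscillation (glued x) (etrans jn (esym blocksn)).
exists n.+1, y; split => //; first exact: leqW.
  exact: in_cell_itv yj.
exact: dist_in_cell yj xj.
Qed.

Lemma glued_small_covers (Z : seq R) :
  small_covers [set x | 0 <= x <= 1 /\ glued x \in Z].
Proof.
have [i _ Si] := blocks_infinite true 0; have [k _ Sk] := blocks_infinite false 0.
have gaps m : exists K, [/\ (0 < K)%N, (m <= K)%N &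
    forall k, (K <= k < m * K)%N -> ~~ blocks k].
  by have [K [? ? bK]] := blocks_gap false m; exists K; split => // l /bK ->.
have gapsC m : exists K, [/\ (0 < K)%N, (m <= K)%N &
    forall k, (K <= k < m * K)%N -> ~~ predC blocks k].
  by have [K [? ? bK]] := blocks_gap true m; exists K; split => // l /bK /= ->.
have left_cover := @lac_small_covers blocks
  [seq z - lac (predC blocks) 2^-1 | z <- Z] (ex_intro _ _ Si) gaps.
have right_cover := @lac_small_covers (predC blocks)
  [seq z - lac blocks 2^-1 | z <- Z] (ex_intro _ k.+1 (negbT Sk)) gapsC.
apply: small_covers_sub (small_coversU left_cover right_cover) => x [/= x01 xZ].
have [x2|/ltW x2] := leP x 2^-1; [left|right]; split => //.
  by apply/mapP; exists (glued x) => //; rewrite glued_left// addrK.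
by apply/mapP; exists (glued x) => //; rewrite glued_right// addrK.
Qed.

Lemma glued_continuous : continuous glued.
Proof.
move=> x; apply/cvgrPdist_le => e e0.
have e20 : 0 < e / 2 by rewrite divr_gt0.
have q01 : 0 <= q < 1 by rewrite (ltW q_gt0).
have [n /(_ n (leqnn n)) Hn] := @geometric_small R (2 * (1 - q)^-1) q _ q01 e20.
have bqn : 0 < 2 * (b%:R * q) ^+ n.
  by rewrite mulr_gt0// exprn_gt0// (lt_le_trans _ bq_ge3).
near=> y.
apply: le_trans (glued_modulus n x y) _.
rewrite mulrDr !mulrA.
suff : 2 * (b%:R * q) ^+ n * `|x - y| <= e / 2 by lra.
rewrite mulrC -ler_pdivlMr// ltW//.
near: y; apply: cvgr_dist_lt; last exact: divr_gt0.
exact: cvg_id.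
Unshelve. all: by end_near.
Qed.

Lemma lac_h_gt1 : (1 < h)%N.
Proof.
rewrite ltnNge; apply/negP => h1; have h_eq1 : h = 1%N by lia.
by move: bq_ge3 q_lt1; rewrite h_eq1; lra.
Qed.

Lemma glued_avoids (c : bool) (Z : seq R) :
  exists x, [/\ 0 <= x <= 1, (x < 2^-1) = c & glued x \notin Z].
Proof.
have [n _ blocksn] := blocks_infinite c 0.
pose j := (if c then 0 else h * b ^ n)%N.
have hbn : (0 < h * b ^ n)%N by rewrite muln_gt0 expn_gt0 muln_gt0 h_gt0.
have jc : (j < h * b ^ n)%N = c by rewrite /j; case: (c) => //; rewrite ltnn.
have jb : (j < b ^ n.+1)%N.
  rewrite expnS -mulnA mul2n -addnn /j; case: (c); first by rewrite ltn_addr.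
  by rewrite -[ltnLHS]addn0 ltn_add2l.
have jblocks := etrans jc (esym blocksn).
have [x xj _] := glued_oscillation 0 jblocks.
have [y yj xy] := glued_oscillation (glued x) jblocks.
have Vxy : glued y - glued x != 0.
  by rewrite -normr_gt0; apply: lt_le_trans xy; rewrite divr_gt0 ?exprn_gt0.
(* One more value than [Z] has entries: equally spaced values between [glued x] and [glued y] are
   distinct and attained in the cell, so one of them is outside [Z]. *)
pose M := (size Z).+1.
have H (i : 'I_M) : exists z, in_cell n.+1 j z /\
    glued z = glued x + (glued y - glued x) * (i%:R / M%:R).
  have [|z [zxy Vz]] := @IVT_convex R glued x y (i%:R / M%:R) glued_continuous.
    by rewrite divr_ge0//= ler_pdivrMr ?ltr0n// mul1r ler_nat ltnW.
  by exists z; split => //; exact: in_cell_convex zxy.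
have [z zP] := choice H.
have [i zi] : exists i, glued (z i) \notin Z.
  apply: contrapT => /forallNP allZ.
  have : (size [seq glued (z i) | i : 'I_M] <= size Z)%N.
    apply: uniq_leq_size; last first.
      by move=> _ /mapP[i _ ->]; apply/negPn/negP; exact: allZ.
    rewrite map_inj_uniq ?enum_uniq// => i i'.
    have [_ ->] := zP i; have [_ ->] := zP i' => /addrI/(mulfI Vxy).
    move=> /mulIf; rewrite invr_eq0 pnatr_eq0 => /(_ isT)/eqP.
    by rewrite eqr_nat => /eqP; exact: val_inj.
  by rewrite size_map size_enum_ord ltnn.
have [zj _] := zP i; exists (z i); split => //; first exact: in_cell_itv zj.
have b0 : (0 : R) < b%:R by exact: lac_base_gt0.
have bn : 0 < b%:R ^+ n.+1 :> R by rewrite exprn_gt0.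
have [ct|cf] := boolP c; last first.
  apply/negbTE; rewrite -leNgt (glued_cell_right _ zj)//.
  by rewrite /j (negbTE cf).
rewrite -(ltr_pM2l bn) half_grid//.
move: zj; rewrite /in_cell /j ct => /andP[_ zj].
(* Here the cell is the first one, and [1 < h] keeps its right end strictly to the left of 1/2. *)
apply: le_lt_trans zj _; rewrite ltr_nat.
by rewrite (leq_trans lac_h_gt1)// leq_pmulr// expn_gt0 muln_gt0 h_gt0.
Qed.

Lemma glued_bounded : exists2 M, 0 < M & forall x, 0 <= x <= 1 -> `|glued x| <= M.
Proof.
have C0 : 0 <= (1 - q)^-1 by rewrite invr_ge0 subr_ge0 ltW.
exists (2 * (1 + (1 - q)^-1) + `|glued 0| + 1).
  by rewrite ltr_wpDl// addr_ge0// mulr_ge0// addr_ge0.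
move=> x /andP[x0 x1]; have := glued_modulus 0 x 0.
rewrite !expr0 subr0 (ger0_norm x0) mul1r mulr1.
have := ler_normD (glued x - glued 0) (glued 0); rewrite subrK; lra.
Qed.

Lemma glued_near x n y : b%:R ^+ n * `|y - x| <= 1 ->
  `|glued y - glued x| <= 2 * (1 + (1 - q)^-1) * q ^+ n.
Proof.
move=> yx; apply: le_trans (glued_modulus n y x) _.
rewrite -mulrA ler_wpM2l// mulrDl mul1r lerD2r exprMn mulrC mulrA.
by rewrite ler_piMl ?exprn_ge0 ?(ltW q_gt0)// mulrC.
Qed.

End glued.

(** * Exponential sums *)

Lemma sub_count_ltn (T : eqType) (a b : pred T) (s : seq T) (c : T) :
  subpred a b -> c \in s -> ~~ a c -> b c -> (count a s < count b s)%N.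
Proof.
move=> ab /perm_to_rem/permP sE nac bc.
by rewrite !sE /= bc (negbTE nac) add0n add1n ltnS sub_count.
Qed.

Section finite_zeros.
Variable R : realType.
Implicit Types (f df : R -> R) (s : seq (R * R)) (t : R).

(** By Rolle's theorem the number of zeros of [df] below [t] strictly increases from one zero of [f]
    to the next, so it injects the zeros of [f] into a finite set. *)
Lemma finite_zeros_of_derivative f df :
  (forall t, is_derive t (1 : R) f (df t)) ->
  finite_set [set t | df t = 0] -> finite_set [set t | f t = 0].
Proof.
move=> fdf /finite_seqP[z zE].
pose g t := count (fun c => c < t) z.
have ltg t t' : f t = 0 -> f t' = 0 -> t < t' -> (g t < g t')%N.
  move=> ft ft' tt'.
  have cf x : {for x, continuous f}.
    by apply: differentiable_continuous; apply/derivable1_diffP; have [] := fdf x.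
  have [||c ctt' [_ dc0]] := @Rolle R f t t' tt' _ _ (etrans ft (esym ft')).
  - by move=> x _; have [] := fdf x.
  - by apply: continuous_subspaceT => x; exact: cf.
  have cz : c \in z.
    have : [set s | df s = 0] c by rewrite /= -dc0; have [_ ->] := fdf c.
    by rewrite zE.
  move: ctt'; rewrite in_itv /= => /andP[tc ct'].
  apply: (sub_count_ltn (c := c)) => // [x /lt_trans|]; first exact.
  by rewrite -leNgt ltW.
have ginj : {in [set t | f t = 0] &, injective g}.
  move=> t t' /set_mem /= ft /set_mem /= ft' gtt'.
  have [tt'|tt'|//] := ltgtP t t'.
    by have := ltg _ _ ft ft' tt'; rewrite gtt' ltnn.
  by have := ltg _ _ ft' ft tt'; rewrite gtt' ltnn.
apply: card_le_finite (_ : finite_set `I_(size z).+1) => //.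
rewrite -(card_le_eql (inj_card_eq ginj)).
apply: subset_card_le => _ [t _ <-] /=.
by rewrite ltnS count_size.
Qed.

Definition expsum s t : R := \sum_(p <- s) p.1 * expR (p.2 * t).

Definition expsum_deriv s := [seq (p.1 * p.2, p.2) | p <- s].

Lemma expsum_nil t : expsum [::] t = 0.
Proof. by rewrite /expsum big_nil. Qed.

Lemma expsum_cons p s t :
  expsum (p :: s) t = p.1 * expR (p.2 * t) + expsum s t.
Proof. by rewrite /expsum big_cons. Qed.

Lemma is_derive_expsum s t :
  is_derive t (1 : R) (expsum s) (expsum (expsum_deriv s) t).
Proof.
elim: s => [|p s IHs].
  have -> : expsum [::] = cst 0 :> (R -> R).
    by apply/funext => x; exact: expsum_nil.
  exact: is_derive_cst.
have -> : expsum (p :: s) =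
    (fun x : R => p.1 *: expR (p.2 *: x)) + expsum s.
  by apply/funext => x; rewrite expsum_cons.
rewrite /= expsum_cons.
apply: is_deriveD.
apply: is_derive_eq.
by rewrite /GRing.scale /= mulr1; ring.
Qed.

(* Dividing by the first exponential and differentiating removes one term. *)
Lemma finite_zeros_expsum s : s != [::] -> all (fun p => p.1 != 0) s ->
  uniq (map snd s) -> finite_set [set t | expsum s t = 0].
Proof.
have [n] := ubnP (size s); elim: n s => // n IHn [//|p s] /= sn _.
move=> /andP[p0 s0] /andP[ps us].
pose s' := [seq (r.1, r.2 - p.2) | r <- p :: s].
have s'E t : expsum (p :: s) t = expR (p.2 * t) * expsum s' t.
  rewrite /expsum big_map mulr_sumr; apply: eq_bigr => r _ /=.
  by rewrite mulrCA -expRD; congr (_ * expR _); ring.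
suff: finite_set [set t | expsum s' t = 0].
  apply: sub_finite_set => t /=; rewrite s'E => /eqP.
  by rewrite mulf_eq0 gt_eqF ?expR_gt0 //= => /eqP.
have [s_nil|s_nnil] := eqVneq s [::].
  apply: sub_finite_set (finite_set0 R) => t /=.
  rewrite /s' s_nil /expsum /= big_seq1 /= subrr mul0r expR0 mulr1.
  by move/eqP; rewrite (negbTE p0).
apply: finite_zeros_of_derivative (is_derive_expsum s') _.
have -> : expsum (expsum_deriv s') =
    expsum [seq (r.1 * (r.2 - p.2), r.2 - p.2) | r <- s].
  apply/funext => t; rewrite /expsum_deriv /s' -map_comp /= expsum_cons /=.
  by rewrite subrr mulr0 mul0r add0r.
apply: IHn; first by rewrite size_map.
- by case: (s) s_nnil.
- rewrite all_map; apply/allP => r rs /=; rewrite mulf_neq0 ?(allP s0) //.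
  rewrite subr_eq0; apply: contraNneq ps => <-; exact: map_f.
- by rewrite -map_comp (map_comp (fun c => c - p.2) snd) map_inj_uniq//; exact: addIr.
Qed.

(** The arguments substituted into a polynomial may repeat, so different monomials can yield the
    same exponent and cancel. Terms are merged before zeros are counted. *)
Lemma expsum_normalize s : all (fun p => 0 < p.2) s ->
  exists s', [/\ all (fun p => p.1 != 0) s', all (fun p => 0 < p.2) s',
    uniq (map snd s') & expsum s' = expsum s].
Proof.
elim: s => [_|p s IHs /= /andP[p0 /IHs[s' [nz pos us sE]]]]; first by exists [::].
have [p1|p1] := eqVneq p.1 0.
  exists s'; split => //; apply/funext => t.
  by rewrite expsum_cons sE p1 mul0r add0r.
have [ps'|ps'] := boolP (p.2 \in map snd s'); last first.
  exists (p :: s'); split => /=; rewrite ?p1 ?p0 ?ps' //.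
  by apply/funext => t; rewrite !expsum_cons sE.
have [[a c] rs' /= cE] := mapP ps'.
have := perm_to_rem rs'; set s2 := rem _ _ => ps2.
move: nz pos us sE.
rewrite (perm_all _ ps2) (perm_all _ ps2) (perm_uniq (perm_map snd ps2)) /=.
move=> /andP[a0 nz] /andP[c0 pos] /andP[cs2 us] sE.
have {}sE t : expsum s t = a * expR (c * t) + expsum s2 t.
  by rewrite -sE /expsum (perm_big _ ps2) big_cons.
have [pa|pa] := eqVneq (p.1 + a) 0.
  exists s2; split => //; apply/funext => t.
  by rewrite expsum_cons sE cE addrA -mulrDl pa mul0r add0r.
exists ((p.1 + a, c) :: s2); split => /=; rewrite ?pa ?c0 ?cs2//.
by apply/funext => t; rewrite !expsum_cons sE /= cE; ring.
Qed.

(** Positive exponents ensure that no term is lost by differentiation. *)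
Lemma finite_critical_points_expsum s : s != [::] ->
  all (fun p => p.1 != 0) s -> all (fun p => 0 < p.2) s ->
  uniq (map snd s) -> finite_set [set t | expsum (expsum_deriv s) t = 0].
Proof.
move=> s_nnil nz pos us; apply: finite_zeros_expsum.
- by case: (s) s_nnil.
- rewrite all_map; apply/allP => p ps /=.
  by rewrite mulf_neq0 ?(allP nz)// gt_eqF ?(allP pos).
- by rewrite -map_comp.
Qed.

Lemma expsum_continuous s : continuous (expsum s).
Proof.
move=> x; apply: differentiable_continuous; apply/derivable1_diffP.
by have [] := is_derive_expsum s x.
Qed.

Lemma expsum_MVT s u v : u <= v -> exists2 c, u <= c <= v &
  expsum s v - expsum s u = expsum (expsum_deriv s) c * (v - u).
Proof.
move=> uv; have [||c cuv E] := @MVT_segment R (expsum s) (expsum (expsum_deriv s)) u v uv.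
- by move=> x _; exact: is_derive_expsum.
- by apply: continuous_subspaceT; exact: expsum_continuous.
- by exists c => //; move: cuv; rewrite in_itv.
Qed.

(** By continuity the derivative keeps at least half its absolute value near [t]; the mean value
    theorem concludes. *)
Lemma expsum_lower_lipschitz s t : expsum (expsum_deriv s) t != 0 ->
  exists e c, [/\ 0 < e, 0 < c & forall u v, `|u - t| < e -> `|v - t| < e ->
    c * `|u - v| <= `|expsum s u - expsum s v|].
Proof.
set g := expsum _ => gt0.
have gt20 : 0 < `|g t| / 2 by rewrite divr_gt0 ?normr_gt0.
have cg : g x @[x --> t] --> g t by exact: expsum_continuous.
move/cvgrPdist_lt/(_ _ gt20)/nbhs_ballP : cg => [e /= e0 eP].
exists e, (`|g t| / 2); split; rewrite ?divr_gt0 ?normr_gt0//.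
suff wlog_uv u v : u <= v -> `|u - t| < e -> `|v - t| < e ->
    `|g t| / 2 * `|v - u| <= `|expsum s v - expsum s u|.
  move=> u v ut vt; have [uv|/ltW vu] := leP u v.
    by rewrite (distrC u) (distrC (expsum s u)) wlog_uv.
  exact: wlog_uv.
move=> uv ut vt.
have [c /andP[uc cv] ->] := expsum_MVT s uv.
rewrite normrM ler_wpM2r//.
have : ball t e c.
  rewrite /ball /= distrC; move: ut vt; rewrite !ltr_norml.
  by move=> /andP[? ?] /andP[? ?]; apply/andP; split; lra.
by move=> /eP /=; have := lerB_dist (g t) (g c); lra.
Qed.

Lemma expsum_lipschitz s (M : R) : exists2 L, 0 < L &
  forall u v, `|u| <= M -> `|v| <= M ->
    `|expsum s u - expsum s v| <= L * `|u - v|.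
Proof.
pose L := \sum_(p <- expsum_deriv s) `|p.1| * expR (`|p.2| * M).
have L0 : 0 <= L.
  by rewrite sumr_ge0// => p _; rewrite mulr_ge0 ?expR_ge0.
have Lb c : `|c| <= M -> `|expsum (expsum_deriv s) c| <= L.
  move=> cM; apply: le_trans (ler_norm_sum _ _ _) _.
  apply: ler_sum => p _; rewrite normrM ler_wpM2l// ger0_norm ?expR_ge0//.
  rewrite ler_expR (le_trans (ler_norm _))// normrM ler_wpM2l//.
exists (L + 1); first by rewrite ltr_wpDl.
suff wlog_uv u v : u <= v -> `|u| <= M -> `|v| <= M ->
    `|expsum s v - expsum s u| <= (L + 1) * `|v - u|.
  move=> u v ut vt; have [uv|/ltW vu] := leP u v.
    by rewrite (distrC u) (distrC (expsum s u)) wlog_uv.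
  exact: wlog_uv.
move=> uv uM vM; have [c /andP[uc cv] ->] := expsum_MVT s uv.
rewrite normrM ler_wpM2r// (le_trans (Lb c _)) ?lerDl//.
move: uM vM; rewrite !ler_norml => /andP[? ?] /andP[? ?].
by apply/andP; split; lra.
Qed.

End finite_zeros.

(** * Exponential sums of the base function *)

Lemma one_le_powR (R : realType) (x a : R) : 1 <= x -> 0 <= a -> 1 <= x `^ a.
Proof.
move=> x1 a0; have <- : 1 `^ a = 1 :> R by rewrite powR1.
by apply: ge0_ler_powR; rewrite ?nnegrE// (le_trans ler01).
Qed.

Lemma powR_le_one (R : realType) (x a : R) :
  0 <= x -> x <= 1 -> 0 <= a -> x `^ a <= 1.
Proof.
move=> x0 x1 a0; have <- : 1 `^ a = 1 :> R by rewrite powR1.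
by apply: ge0_ler_powR; rewrite ?nnegrE.
Qed.

Lemma one_lt_powR (R : realType) (x a : R) : 1 < x -> 0 < a -> 1 < x `^ a.
Proof.
move=> x1 a0; have <- : 1 `^ a = 1 :> R by rewrite powR1.
by apply: gt0_ltr_powR; rewrite ?nnegrE// (le_trans ler01)// ltW.
Qed.

Lemma half_le_truncn (R : realType) (t : R) :
  2 <= t -> t <= 2 * (Num.truncn t)%:R.
Proof. by move=> t2; have := truncnS_gt t; rewrite -natr1; lra. Qed.

Section membership.
Variables (R : realType) (alpha : R) (h : nat).
Local Notation b := (2 * h)%N.
Local Notation q := (b%:R `^ (- alpha)).
Hypotheses (alpha_gt0 : 0 < alpha) (alpha_lt1 : alpha < 1).
Hypotheses (h_gt0 : (0 < h)%N) (q_gt0 : 0 < q) (q_lt1 : q < 1).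
Hypothesis bq_ge3 : 3 <= b%:R * q.
Implicit Types (x y z delta : R) (n : nat).
Local Notation in_cell := (@in_cell R h).
Local Notation V := (glued h q).

Lemma pow_scale n : (b%:R ^+ n) `^ alpha * q ^+ n = 1.
Proof.
have b0 : (0 : R) < b%:R by exact: lac_base_gt0.
rewrite -!powR_mulrn ?(ltW b0) ?(ltW q_gt0)// -!powRrM mulNr powRN.
by rewrite [_ * alpha]mulrC mulfV// gt_eqF// powR_gt0.
Qed.

Lemma scale_powR_ge n delta : 0 < delta -> 1 <= b%:R ^+ n * delta ->
  q ^+ n <= delta `^ alpha.
Proof.
move=> delta0 bdelta; have b0 : (0 : R) < b%:R by exact: lac_base_gt0.
have bn : 0 < b%:R ^+ n :> R by rewrite exprn_gt0.
have := one_le_powR bdelta (ltW alpha_gt0).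
rewrite powRM ?(ltW bn) ?(ltW delta0)// => H.
have /(ler_wpM2l) /(_ _ _ H) := exprn_ge0 n (ltW q_gt0).
by rewrite mulr1 mulrCA mulrA pow_scale mul1r.
Qed.

(** Since [b^2 * q = b^(2 - alpha)], the right-hand side is [(b^n)^(2 - alpha)]. *)
Lemma scale_powR_le n delta : 0 < delta -> 1 <= b%:R ^+ n * delta ->
  delta `^ (- (2 - alpha)) <= (b%:R ^+ 2 * q) ^+ n.
Proof.
move=> delta0 bdelta; have b0 : (0 : R) < b%:R by exact: lac_base_gt0.
have bn : 0 < b%:R ^+ n :> R by rewrite exprn_gt0.
have qn : q ^+ n = (b%:R ^+ n) `^ (- alpha).
  have H := pow_scale n; rewrite [RHS]powRN.
  have ba : (b%:R ^+ n) `^ alpha != 0 by rewrite gt_eqF// powR_gt0.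
  by apply: (mulfI ba); rewrite H mulfV.
have -> : (b%:R ^+ 2 * q) ^+ n = (b%:R ^+ n) `^ (2 - alpha).
  rewrite powRD ?(gt_eqF bn) ?implybT// powR_mulrn ?(ltW bn)// -qn.
  by rewrite exprMn exprAC.
have beta0 : 0 <= 2 - alpha.
  by rewrite subr_ge0 (le_trans (ltW alpha_lt1))// ler1n.
have := one_le_powR bdelta beta0.
rewrite powRM ?(ltW bn) ?(ltW delta0)// powRN => H.
by rewrite -[leLHS]mul1r ler_pdivrMr// powR_gt0.
Qed.

(** For [b^-(n+1) <= |x - y| < b^-n], both terms of the modulus are of order [q ^+ n], and
    [q ^+ n.+1] is at most [|x - y|^alpha]. Distance 1 falls outside this choice and is treated with
    [n = 0]. *)
Lemma glued_holder x y : 0 <= x <= 1 -> 0 <= y <= 1 ->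
  `|V x - V y| <= 2 * (1 + (1 - q)^-1) / q * `|x - y| `^ alpha.
Proof.
move=> /andP[x0 x1] /andP[y0 y1].
have C0 : 0 <= (1 - q)^-1 by rewrite invr_ge0 subr_ge0 ltW.
have qq : 0 <= q^-1 by rewrite invr_ge0 ltW.
have A0 : 0 <= 2 * (1 + (1 - q)^-1) by rewrite mulr_ge0// addr_ge0.
have AQ0 := mulr_ge0 A0 qq.
have [->|xy] := eqVneq x y.
  by rewrite !subrr normr0; apply: mulr_ge0 AQ0 (powR_ge0 _ _).
have d0 : 0 < `|x - y| by rewrite normr_gt0 subr_eq0.
have d1 : `|x - y| <= 1 by rewrite ler_norml; apply/andP; split; lra.
have modulus := glued_modulus q_gt0 q_lt1 bq_ge3 _ x y.
have [d_lt1|d_ge1] := ltP `|x - y| 1; last first.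
  have dE : `|x - y| = 1 by apply/eqP; rewrite eq_le d1.
  rewrite [in leRHS]dE powR1 mulr1; apply: le_trans (modulus 0%N) _.
  by rewrite !expr0 dE !mul1r mulr1 ler_pdivlMr// ler_piMr// ltW.
have b1 : (1 < b)%N by rewrite mul2n -addnn (leq_add h_gt0 h_gt0).
have d01 : 0 < `|x - y| < 1 by rewrite d0.
have [n /andP[bn bSn]] := scale_exists b1 d01.
apply: le_trans (modulus n) _.
apply: (@le_trans _ _ (2 * (1 + (1 - q)^-1) / q * q ^+ n.+1)); last first.
  by rewrite ler_wpM2l// scale_powR_ge.
rewrite exprS mulrA mulfVK ?gt_eqF// -mulrA ler_wpM2l// mulrDl mul1r lerD2r.
by rewrite exprMn mulrC mulrA ler_piMl ?exprn_ge0 ?(ltW q_gt0)// mulrC ltW.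
Qed.

Section composition.
Variable s : seq (R * R).
Hypothesis s_crit : finite_set [set t | expsum (expsum_deriv s) t = 0].
Local Notation F := (fun x : R => expsum s (V x)).

Lemma composed_holder : exists2 C, 0 < C & forall x y,
  0 <= x <= 1 -> 0 <= y <= 1 -> `|F x - F y| <= C * `|x - y| `^ alpha.
Proof.
have C0 : 0 <= (1 - q)^-1 by rewrite invr_ge0 subr_ge0 ltW.
have [M M0 VM] := glued_bounded q_gt0 q_lt1 bq_ge3.
have [L L0 lipL] := expsum_lipschitz s M.
exists (L * (2 * (1 + (1 - q)^-1) / q)).
  by rewrite mulr_gt0// divr_gt0// mulr_gt0// ltr_wpDr.
move=> x y x01 y01; apply: le_trans (lipL _ _ (VM _ x01) (VM _ y01)) _.
by rewrite -mulrA ler_wpM2l ?(ltW L0)// glued_holder.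
Qed.

(** In each half some point is sent by [V] to a noncritical point of the exponential sum; on a small
    enough cell around it, [F] oscillates at least like a multiple of [V]. *)
Lemma bi_lipschitz_cell (c : bool) : exists k j e, [/\ 0 < e,
    (j < b ^ k.+1)%N, (j < h * b ^ k)%N = c &
    forall y z, in_cell k.+1 j y -> in_cell k.+1 j z ->
      e * `|V y - V z| <= `|F y - F z|].
Proof.
have [Z ZE] := (finite_seqP _).1 s_crit.
have [x0 [x01 x0c VZ]] := glued_avoids h_gt0 q_gt0 q_lt1 bq_ge3 c Z.
have dV : expsum (expsum_deriv s) (V x0) != 0.
  apply: contra VZ => /eqP dV0.
  by have : [set t | expsum (expsum_deriv s) t = 0] (V x0) by []; rewrite ZE.
have [e [cc [e0 cc0 low]]] := expsum_lower_lipschitz dV.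
have q01 : 0 <= q < 1 by rewrite (ltW q_gt0).
have e20 : 0 < e / 2 by rewrite divr_gt0.
have [k Hk] := @geometric_small R (2 * (1 + (1 - q)^-1)) q _ q01 e20.
have [j [jb xj jc]] := glued_cell h_gt0 k x01.
exists k, j, cc; split => //; first by rewrite jc.
have near_x0 z : in_cell k.+1 j z -> `|V z - V x0| < e.
  move=> zj; have zx0 := dist_in_cell h_gt0 zj xj.
  apply: le_lt_trans (glued_near q_gt0 q_lt1 bq_ge3 zx0) _.
  apply: le_lt_trans (Hk _ (leqnSn k)) _.
  by rewrite ltr_pdivrMr// ltr_pMr// ltr1n.
by move=> y z yj zj; apply: low; exact: near_x0.
Qed.

Lemma in_subcell k m j r x : (r < b ^ m)%N ->
  in_cell (k + m) (j * b ^ m + r) x -> in_cell k j x.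
Proof.
have b0 : (0 : R) < b%:R by exact: lac_base_gt0.
have bm : 0 < b%:R ^+ m :> R by rewrite exprn_gt0.
move=> rb; rewrite /in_cell exprD mulrAC => /andP[xj jx].
rewrite -(ler_pM2r bm) -[X in _ && X](ler_pM2r bm) -natrX -!natrM natrX.
apply/andP; split; first by apply: le_trans xj; rewrite ler_nat leq_addr.
by apply: le_trans jx _; rewrite ler_nat mulSn addnC -addSn leq_add2r.
Qed.

(** The cell of [bi_lipschitz_cell] on the half carrying the frequency [n.+1] splits into cells of
    generation [n.+1], on each of which [V] oscillates by [q ^+ n.+1 / 4]; [graph_cover_ge] is
    applied to every other one. *)
Lemma composed_cover_ge (c : bool) : exists c0 n0, 0 < c0 /\
  forall n delta N, (n0 <= n)%N -> blocks n.+1 = c -> 0 < delta ->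
    b%:R ^+ n.+1 * delta < 1 <= b%:R ^+ n.+2 * delta ->
    cube_covered (itv_graph F) delta N ->
    c0 * delta `^ (- (2 - alpha)) <= N%:R.
Proof.
have [k [j [e [e0 jb jc low]]]] := bi_lipschitz_cell c.
have b0 : (0 : R) < b%:R by exact: lac_base_gt0.
have bN0 : (0 < b)%N by rewrite muln_gt0 h_gt0.
have bq0 : 0 < b%:R * q by rewrite mulr_gt0.
have bqV01 : 0 <= (b%:R * q)^-1 < 1.
  rewrite invr_ge0 (ltW bq0) invf_lt1//=.
  by apply: lt_le_trans bq_ge3; rewrite ltr1n.
(* The constant 8 gives [e * (b q)^(n+1) / 4 >= 2], so that truncating this number to [M] loses at
   most a factor 2. *)
have [n1 Hn1] := @geometric_small R 8 (b%:R * q)^-1 e bqV01 e0.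
(* 16 collects the factors 2 for using every other cell, 4 from the oscillation and 2 from the
   truncation. The last divisor accounts for [delta] being compared with generation [n.+2]. *)
exists (e / 16 / b%:R ^+ k.+1 / (b%:R ^+ 2 * q)), (n1 + k.+1)%N; split.
  by rewrite !divr_gt0 ?exprn_gt0// mulr_gt0// exprn_gt0.
move=> n delta N n0n blocksn delta0 /andP[bdelta1 bdelta2] cover.
have kn : (k < n)%N by apply: leq_trans n0n; rewrite leq_addl.
have n1n : (n1 <= n.+1)%N by apply/leqW/(leq_trans _ n0n); rewrite leq_addr.
pose m := (n - k)%N; have nE : n.+1 = (k.+1 + m)%N by rewrite /m addSn (subnKC (ltnW kn)).
have m0 : (0 < m)%N by rewrite subn_gt0.
pose w := q ^+ n.+1 / 4.
pose M := Num.truncn (e * w * b%:R ^+ n.+1).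
have ew0 : 0 <= e * w * b%:R ^+ n.+1.
  by rewrite !mulr_ge0 ?exprn_ge0 ?(ltW e0) ?(ltW q_gt0) ?(ltW b0) ?invr_ge0.
have subr u : (u < h * b ^ m.-1)%N -> (u.*2 < b ^ m)%N.
  move=> uL; rewrite -(prednK m0) expnS -mulnA mul2n.
  by rewrite ltn_double.
have MN : (h * b ^ m.-1 * M <= N)%N.
  apply: (@graph_cover_ge R h F V [set x | in_cell k.+1 j x] n.+1 (j * b ^ m)%N
    (h * b ^ m.-1)%N M N e w delta) => //.
  - exact: glued_continuous.
  - move=> u uL.
    have ublocks : (j * b ^ m + u.*2 < h * b ^ n)%N = blocks n.+1.
      rewrite blocksn -jc (_ : n = k + m)%N ?expnD ?mulnA; last first.
        by rewrite /m (subnKC (ltnW kn)).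
      have [jk|jk] := ltnP j (h * b ^ k).
        apply: (@leq_trans (j.+1 * b ^ m)); last by rewrite leq_mul2r jk orbT.
        by rewrite mulSn addnC ltn_add2r subr.
      apply/negbTE; rewrite -leqNgt; apply: leq_trans (leq_addr _ _).
      by rewrite leq_mul2r jk orbT.
    have [y yj _] := glued_oscillation h_gt0 q_gt0 q_lt1 bq_ge3 0 ublocks.
    have [z zj yz] := glued_oscillation h_gt0 q_gt0 q_lt1 bq_ge3 (V y) ublocks.
    by exists z, y.
  - by move=> u x uL; rewrite nE; apply: in_subcell; exact: subr.
  - by move=> x; apply: in_cell_itv.
  - by rewrite /M truncn_le.
have tE : e * w * b%:R ^+ n.+1 = e * (b%:R * q) ^+ n.+1 / 4.
  by rewrite /w exprMn; ring.
have M_ge : e * w * b%:R ^+ n.+1 <= 2 * M%:R.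
  apply: half_le_truncn; rewrite tE ler_pdivlMr// -natrM.
  by have := Hn1 _ n1n; rewrite exprVn ler_pdivrMr// exprn_gt0.
have LE : (h * b ^ m.-1)%:R = b%:R ^+ n.+1 / (2 * b%:R ^+ k.+1) :> R.
  have bmE : b%:R ^+ m = 2 * (h * b ^ m.-1)%:R :> R.
    by rewrite -natrX -{1}(prednK m0) expnS -mulnA natrM.
  by rewrite nE exprD bmE; field; rewrite expf_neq0// gt_eqF.
apply: (@le_trans _ _ ((h * b ^ m.-1 * M)%:R)); last by rewrite ler_nat.
apply: (@le_trans _ _ (e / 16 / b%:R ^+ k.+1 / (b%:R ^+ 2 * q) *
    (b%:R ^+ 2 * q) ^+ n.+2)).
  rewrite ler_wpM2l ?scale_powR_le//.
  by rewrite !divr_ge0 ?exprn_ge0 ?mulr_ge0 ?exprn_ge0 ?(ltW e0) ?(ltW q_gt0) ?(ltW b0).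
rewrite [leRHS]natrM LE.
have b2q : b%:R ^+ 2 * q != 0 by rewrite gt_eqF// mulr_gt0// exprn_gt0.
have bk : b%:R ^+ k.+1 != 0 :> R by rewrite expf_neq0// gt_eqF.
rewrite [(_ * q) ^+ n.+2]exprS mulrA mulfVK //.
have -> : e / 16 / b%:R ^+ k.+1 * (b%:R ^+ 2 * q) ^+ n.+1 =
    b%:R ^+ n.+1 / (2 * b%:R ^+ k.+1) * (e * w * b%:R ^+ n.+1 / 2).
  by rewrite exprMn exprAC /w; field.
rewrite ler_wpM2l ?divr_ge0 ?mulr_ge0 ?exprn_ge0 ?(ltW b0)//.
by rewrite ler_pdivrMr // [leRHS]mulrC.
Qed.

(** The upper bound is the Hoelder one. For the lower bound, every frequency is carried by one of
    the halves, so the smaller of the two constants works at all small scales. *)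
Lemma composed_box_dim : has_box_dim (itv_graph F) (2 - alpha).
Proof.
have [C C0 FC] := composed_holder.
have [c1 [n1 [c10 H1]]] := composed_cover_ge true.
have [c2 [n2 [c20 H2]]] := composed_cover_ge false.
have b0 : (0 : R) < b%:R by exact: lac_base_gt0.
have b1 : (1 < b)%N by rewrite mul2n -addnn (leq_add h_gt0 h_gt0).
pose n0 := maxn n1 n2; pose d0 : R := (b%:R ^+ n0.+1)^-1.
have bn0 : 0 < b%:R ^+ n0.+1 :> R by rewrite exprn_gt0.
have b1R : 1 <= b%:R :> R by rewrite ler1n ltnW.
have d01 : d0 <= 1 by rewrite invf_le1// exprn_ege1.
have [M M0 VM] := glued_bounded q_gt0 q_lt1 bq_ge3.
have [L L0 lipL] := expsum_lipschitz s M.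
apply: (@has_box_dim_bounds _ _ _ _ (Num.min c1 c2) (2 * (2 * C + 1)) d0).
- have [K K0 FK] : exists2 K, 0 < K & forall x, 0 <= x <= 1 -> `|F x| <= K.
    exists (L * (M + M) + `|F 0| + 1).
      by rewrite ltr_wpDl// addr_ge0// mulr_ge0 ?addr_ge0 ?(ltW L0) ?(ltW M0).
    move=> x x01; have zero01 : 0 <= (0 : R) <= 1 by rewrite lexx ler01.
    have := lipL _ _ (VM _ x01) (VM _ zero01).
    have := ler_wpM2l (ltW L0) (ler_normB (V x) (V 0)).
    have := ler_wpM2l (ltW L0) (lerD (VM _ x01) (VM _ zero01)).
    have := ler_normD (F x - F 0) (F 0); rewrite subrK.
    lra.
  exact: graph_bounded FK.
- by rewrite lt_min c10.
- by rewrite invr_gt0.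
- move=> delta /andP[delta0 delta_d0]; apply: holder_graph_cover => //.
    by rewrite alpha_gt0.
  by rewrite delta0 (lt_le_trans delta_d0).
move=> delta N /andP[delta0 delta_d0] cover.
have bn0_delta : b%:R ^+ n0.+1 * delta < 1.
  by rewrite mulrC -ltr_pdivlMr// div1r.
(* Applied to [b * delta] instead of [delta], this locates the scale between generations [n.+1] and
   [n.+2]. *)
have [|n /andP[bn bSn]] := @scale_exists R b (b%:R * delta) b1.
  rewrite mulr_gt0//=; apply: le_lt_trans bn0_delta.
  by rewrite ler_wpM2r ?(ltW delta0)// ler_eXnr.
rewrite !mulrA -!exprSr in bn bSn.
have nn0 : (n0 <= n)%N.
  rewrite leqNgt; apply/negP => n_lt; move: bSn; rewrite leNgt => /negP; apply.
  apply: le_lt_trans bn0_delta; rewrite ler_wpM2r ?(ltW delta0)//.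
  by rewrite ler_weXn2l// ltnS.
have bb : b%:R ^+ n.+1 * delta < 1 <= b%:R ^+ n.+2 * delta by rewrite bn.
have ds0 := powR_ge0 delta (- (2 - alpha)).
have [blocksn|blocksn] := boolP (blocks n.+1).
  apply: le_trans (H1 n delta N _ blocksn delta0 bb cover).
    by rewrite ler_wpM2r// ge_min lexx.
  by apply: leq_trans nn0; exact: leq_maxl.
apply: le_trans (H2 n delta N _ (negbTE blocksn) delta0 bb cover).
  by rewrite ler_wpM2r// ge_min lexx orbT.
by apply: leq_trans nn0; exact: leq_maxr.
Qed.

Lemma powR_pointwise_bound n (d g : R) : 0 < g -> 0 <= d ->
  b%:R ^+ n * d <= 1 -> d `^ g <= (b%:R `^ g)^-1 ^+ n.
Proof.
move=> g0 d0 bd; have b0 : (0 : R) < b%:R by exact: lac_base_gt0.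
have bn : 0 <= b%:R ^+ n :> R by rewrite exprn_ge0.
rewrite exprVn -[leRHS]mul1r ler_pdivlMr ?exprn_gt0 ?powR_gt0//.
rewrite -powR_mulrn ?powR_ge0// -powRrM mulrC [g * _]mulrC powRrM powR_mulrn//.
by rewrite -powRM// powR_le_one ?mulr_ge0// ltW.
Qed.

(** At infinitely many scales [b^-n], [F] moves by at least [c * q^n / 4], while the bound allows
    only [|K| * b^(- g n) = |K| * q^n * t^n] with [t = b^(alpha - g) < 1]. *)
Lemma composed_not_holder_at (x0 g K eta : R) : 0 <= x0 <= 1 ->
  expsum (expsum_deriv s) (V x0) != 0 -> alpha < g -> 0 < eta ->
  ~ (forall y, 0 <= y <= 1 -> `|y - x0| < eta ->
      `|F y - F x0| <= K * `|y - x0| `^ g).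
Proof.
move=> x01 dV ag eta0 Hg.
have b0 : (0 : R) < b%:R by exact: lac_base_gt0.
have g0 : 0 < g by exact: lt_trans ag.
have q01 : 0 <= q < 1 by rewrite (ltW q_gt0).
have [e [c [e0 c0 low]]] := expsum_lower_lipschitz dV.
have b1 : 1 < b%:R :> R by rewrite ltr1n mul2n -addnn (leq_add h_gt0 h_gt0).
have bV01 : 0 <= (b%:R : R)^-1 < 1 by rewrite invr_ge0 ltW//= invf_lt1.
pose t := b%:R `^ (alpha - g).
have t01 : 0 <= t < 1.
  rewrite powR_ge0 /= /t -(opprB g) powRN invf_lt1 ?powR_gt0//.
  by rewrite one_lt_powR// subr_gt0.
have tE : (b%:R `^ g)^-1 = q * t.
  rewrite -powRN -powRD; last by rewrite (gt_eqF b0) implybT.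
  congr (_ `^ _).
  by rewrite addrA addNr sub0r.
have eta20 : 0 < eta / 2 by rewrite divr_gt0.
have e20 : 0 < e / 2 by rewrite divr_gt0.
have half_gt0 : 0 < 2^-1 :> R by rewrite invr_gt0.
(* Three thresholds: [y] within [eta] of [x0], [V y] within [e] of [V x0], and [t ^+ n] small enough
   for the contradiction. *)
have [n1 H1] := @geometric_small R 1 _ _ bV01 eta20.
have [n2 H2] := @geometric_small R (2 * (1 + (1 - q)^-1)) q _ q01 e20.
have [n3 H3] := @geometric_small R (4 * `|K| / c) t _ t01 half_gt0.
have [n [y [Nn y01 yx osc]]] := glued_pointwise_oscillation h_gt0 q_gt0 q_lt1
  bq_ge3 (n1 + n2 + n3) x01.
have n1n : (n1 <= n)%N by apply: leq_trans Nn; rewrite -addnA leq_addr.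
have n2n : (n2 <= n)%N by apply: leq_trans Nn; rewrite addnAC leq_addl.
have n3n : (n3 <= n)%N by apply: leq_trans Nn; rewrite leq_addl.
have bn : 0 < b%:R ^+ n :> R by rewrite exprn_gt0.
have y_eta : `|y - x0| < eta.
  apply: (@le_lt_trans _ _ (eta / 2)); last first.
    by rewrite ltr_pdivrMr// ltr_pMr// ltr1n.
  apply: le_trans (H1 n n1n); rewrite mul1r exprVn.
  by rewrite -[leRHS]mul1r ler_pdivlMr// mulrC.
have Vy : `|V y - V x0| < e.
  apply: le_lt_trans (glued_near q_gt0 q_lt1 bq_ge3 yx) _.
  apply: le_lt_trans (H2 n n2n) _.
  by rewrite ltr_pdivrMr// ltr_pMr// ltr1n.
have Vx0 : `|V x0 - V x0| < e by rewrite subrr normr0.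
have yg := powR_pointwise_bound g0 (normr_ge0 _) yx.
rewrite tE exprMn in yg.
have := Hg y y01 y_eta; have := low _ _ Vy Vx0 => /le_trans H /H {}H.
have qn : 0 < q ^+ n by rewrite exprn_gt0.
have {H}H : c * (q ^+ n / 4) <= `|K| * (q ^+ n * t ^+ n).
  apply: le_trans (ler_wpM2l (ltW c0) osc) _; apply: le_trans H _.
  apply: le_trans (ler_wpM2r (powR_ge0 _ _) (ler_norm K)) _.
  exact: ler_wpM2l.
have {}H : 1 <= 4 * `|K| / c * t ^+ n.
  rewrite -(ler_pM2l (_ : 0 < c * (q ^+ n / 4))); last first.
    by rewrite mulr_gt0 ?divr_gt0.
  rewrite mulr1; apply: le_trans H _; rewrite le_eqVlt; apply/orP; left.
  by apply/eqP; field; rewrite gt_eqF.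
have := le_trans H (H3 n n3n); rewrite leNgt => /negP; apply.
by rewrite invf_lt1// ltr1n.
Qed.

(** A constant polynomial shows that [alpha] is attained. For a larger [g], the polynomial [P] is
    itself Lipschitz at [x0], so it can be replaced by [F (val x0)] after lowering [g] to
    [Num.min g 1], which still exceeds [alpha] because [alpha < 1]. *)
Lemma composed_holder_exponent (x0 : unit_itv R) :
  expsum (expsum_deriv s) (V (val x0)) != 0 ->
  holder_exponent (fun x : unit_itv R => F (val x)) x0 = alpha%:E.
Proof.
move=> dV; have x01 := val_unit_itv x0.
have [A A0 FA] := composed_holder.
apply/eqP; rewrite eq_le; apply/andP; split; last first.
  apply: ereal_sup_ubound; exists alpha => //; split; first exact: ltW.
  exists A, (F (val x0))%:P; split => //.
    by rewrite size_polyC; case: (_ != 0).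
  by near=> x; rewrite hornerC; apply: FA => //; exact: val_unit_itv.
apply: ge_ereal_sup => _ [g [g0 [K [P [K0 _ near_x0]]]] <-].
rewrite lee_fin leNgt; apply/negP => ag.
have g_gt0 : 0 < g by exact: lt_trans ag.
have [eta /= eta0 etaP] : exists2 eta, 0 < eta & forall y : unit_itv R,
    `|val y - val x0| < eta ->
    `|F (val y) - P.[val y]| <= K * `|val y - val x0| `^ g.
  have /nbhs_ballP[eta /= eta0 etaP] := near_x0.
  exists eta => // y y_eta; apply: etaP.
  suff: ball (val x0) eta (val y) by [].
  by rewrite /ball /= distrC.
have Px0 : P.[val x0] = F (val x0).
  have := etaP x0; rewrite subrr normr0 powR0 ?gt_eqF// mulr0.
  by move=> /(_ eta0); rewrite normr_le0 subr_eq0 => /eqP.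
have [Q QE] : exists Q, P - P.[val x0]%:P = Q * ('X - (val x0)%:P).
  by apply/factor_theorem; rewrite /root !hornerE subrr.
have [B HB] := poly_itv_bound Q 0 1.
pose gm := Num.min g 1.
have a_gm : alpha < gm by rewrite lt_min ag.
apply: (@composed_not_holder_at (val x0) gm (K + `|B|) eta) => // y y01 y_eta.
have [y' yE] := unit_itv_val y01.
have d1 : 0 <= `|y - val x0| <= 1.
  by rewrite normr_ge0 ler_norml; move: x01 y01 => /andP[? ?] /andP[? ?];
    apply/andP; split; lra.
have pow_gm a : gm <= a -> `|y - val x0| `^ a <= `|y - val x0| `^ gm.
  have [->|d0] := eqVneq `|y - val x0| 0.
    move=> gma; rewrite !powR0 ?gt_eqF//; first exact: lt_trans a_gm.
    by apply: lt_le_trans gma; exact: lt_trans a_gm.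
  move=> gma; apply: ger_powR => //; rewrite lt_neqAle eq_sym d0.
  by case/andP: d1 => -> ->.
have H1 : `|F y - P.[y]| <= K * `|y - val x0| `^ gm.
  have := etaP y'; rewrite yE => /(_ y_eta) /le_trans; apply.
  by rewrite ler_wpM2l ?(ltW K0)// pow_gm// ge_min lexx.
have H2 : `|P.[y] - P.[val x0]| <= `|B| * `|y - val x0| `^ gm.
  have -> : P.[y] - P.[val x0] = Q.[y] * (y - val x0).
    by have := congr1 (fun p => p.[y]) QE; rewrite !hornerE.
  rewrite normrM; apply: ler_pM => //.
    by apply: le_trans (HB y y01) _; exact: ler_norm.
  rewrite -[leLHS]powRr1//; apply: pow_gm.
  by rewrite ge_min lexx orbT.
rewrite -Px0 mulrDl; apply: le_trans (lerD H1 H2).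
by apply: le_trans (ler_normD _ _); rewrite addrA subrK.
Unshelve. all: by end_near.
Qed.

Lemma composed_member (f := fun x : unit_itv R => F (val x)) :
  [/\ holder alpha f, has_box_dim (graph f) (2 - alpha) &
      exists E : set R, [/\ E `<=` `[0, 1]%classic, hausdorff_dim E = 0%E &
        forall x0 : unit_itv R, ~ E (val x0) ->
          holder_exponent f x0 = alpha%:E]].
Proof.
split.
- have [C C0 FC] := composed_holder; exists C => // x y.
  by apply: FC; exact: val_unit_itv.
- exact: composed_box_dim.
have [Z ZE] := (finite_seqP _).1 s_crit.
(* The exceptional set consists of the points sent by [V] to critical points of the exponential
   sum. *)
exists [set x | 0 <= x <= 1 /\ V x \in Z]; split.
- by move=> x [x01 _]; rewrite /= in_itv.
- by apply: hausdorff_dim_small_covers; exact: glued_small_covers.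
move=> x0 x0E; apply: composed_holder_exponent; apply/eqP => dV.
apply: x0E; split; first exact: val_unit_itv.
have : [set t | expsum (expsum_deriv s) t = 0] (V (val x0)) by [].
by rewrite ZE.
Qed.

End composition.
End membership.

(** * A linearly independent family of reals *)

Lemma injective_nat_unbounded (f : nat -> nat) (N : nat) :
  injective f -> exists n, (N <= f n)%N.
Proof.
move=> f_inj; apply: contrapT => /forallNP fN.
have {}fN n : (f n < N)%N by rewrite ltnNge; apply/negP; exact: fN.
have : injective (fun i : 'I_N.+1 => Ordinal (fN i)).
  by move=> i j [/f_inj]; exact: val_inj.
by move=> /leq_card; rewrite !card_ord ltnn.
Qed.

Section independent_reals.
Variable R : realType.
Implicit Types (r : R) (n k : nat).

(* Every interval with rational end points is listed at infinitely many k. *)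
Definition digit r k : bool :=
  if @unpickle (rat * rat * nat)%type k is Some (u, v, _)
  then ratr u < r < ratr v else false.

(** With factorial denominators, [n!] times the [n]-th partial sum is an integer, while [n!] times
    the tail is at most [2 / n.+1]. *)
Definition indep_part r n : R := \sum_(k < n) (digit r k)%:R / k.+1`!%:R.

Definition indep r : R := sup (range (indep_part r)).

Lemma indep_partS r n :
  indep_part r n.+1 = indep_part r n + (digit r n)%:R / n.+1`!%:R.
Proof. by rewrite /indep_part big_ord_recr. Qed.

Lemma indep_part_tail r n m :
  indep_part r m <= indep_part r n + 2 / n.+1`!%:R.
Proof.
have fact_pos i : 0 < i`!%:R :> R by rewrite ltr0n fact_gt0.
have [mn|/ltnW nm] := leqP m n.
  apply: (@le_trans _ _ (indep_part r n)); last by rewrite lerDl divr_ge0 ?ltW.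
  rewrite -(subnK mn); elim: (n - m)%N => // k IHk.
  by apply: le_trans IHk _; rewrite addSn indep_partS lerDl divr_ge0 ?ler0n.
(* Adding [2 / n.+1!] makes the partial sums nonincreasing, as
   [1 / n.+1! + 2 / n.+2! <= 2 / n.+1!]. *)
suff: indep_part r m + 2 / m.+1`!%:R <= indep_part r n + 2 / n.+1`!%:R.
  by apply: le_trans; rewrite lerDl divr_ge0 ?ltW.
rewrite -(subnK nm); elim: (m - n)%N => // k; apply: le_trans.
rewrite addSn indep_partS -addrA lerD2l; set j := (k + n)%N.
have -> : (2 : R) = 1 + 1 by [].
rewrite [leRHS]mulrDl; apply: lerD.
  by rewrite ler_pM2r ?invr_gt0//; case: digit; rewrite ?ler01.
rewrite [j.+2`!]factS natrM ler_pdivrMr; last first.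
  by apply: mulr_gt0; rewrite ?ltr0n ?fact_gt0.
have -> : 1 / j.+1`!%:R * (j.+2%:R * j.+1`!%:R) = j.+2%:R :> R.
  by field; rewrite gt_eqF//.
by rewrite (ler_nat _ 2).
Qed.

Lemma indep_bounds r n :
  indep_part r n <= indep r <= indep_part r n + 2 / n.+1`!%:R.
Proof.
exact: (@sup_range_bounds _ (indep_part r) (fun n => 2 / n.+1`!%:R)
  (fun n m => indep_part_tail r n m)).
Qed.

Lemma indep_part_int r n : n`!%:R * indep_part r n \is a Num.int.
Proof.
elim: n => [|n IHn]; first by rewrite /indep_part big_ord0 mulr0 rpred0.
have fn : n.+1`!%:R != 0 :> R by rewrite pnatr_eq0 -lt0n fact_gt0.
rewrite indep_partS mulrDr mulrCA divff// mulr1 rpredD ?natr_int//.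
by rewrite factS natrM -mulrA rpredM ?natr_int.
Qed.

Lemma isolating_rationals m (r : 'I_m -> R) (i0 : 'I_m) : injective r ->
  exists u v : rat, forall i, (ratr u < r i < ratr v) = (i == i0).
Proof.
move=> r_inj.
pose d : R := \big[Num.min/1]_(i | i != i0) `|r i - r i0|.
have d0 : 0 < d.
  apply: lt_bigmin => // i ii0.
  by rewrite normr_gt0 subr_eq0; apply: contraNneq ii0 => /r_inj ->.
have dle i : i != i0 -> d <= `|r i - r i0| by move=> ?; exact: bigmin_le_cond.
have [|u] := @rat_in_itvoo R (r i0 - d) (r i0); first by lra.
rewrite in_itv /= => /andP[u1 u2].
have [|v] := @rat_in_itvoo R (r i0) (r i0 + d); first by lra.
rewrite in_itv /= => /andP[v1 v2].
exists u, v => i; have [->|/dle di] := eqVneq i i0; first by rewrite u2 v1.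
apply/negbTE/negP => /andP[? ?]; move: di; apply/negP; rewrite -ltNge ltr_norml.
by apply/andP; split; lra.
Qed.

(* Multiplying a relation by n! turns its n-th partial sum into an integer that
   tends to 0, hence vanishes for n large; so do then the digits. *)
Lemma indep_free m (r : 'I_m -> R) (z : 'I_m -> int) : injective r ->
  \sum_i (z i)%:~R * indep (r i) = 0 -> forall i, z i = 0.
Proof.
move=> r_inj rel i0.
pose M : R := \sum_i `|(z i)%:~R|.
have M0 : 0 <= M by apply: sumr_ge0 => i _.
(* For [n >= N] the integer [n! * A] is at most [2 * M / n.+1 < 1] in absolute value. *)
pose N := Num.truncn (2 * M).
have part0 n : (N <= n)%N -> \sum_i (z i)%:~R * indep_part (r i) n = 0 :> R.
  move=> Nn; have fn : 0 < n`!%:R :> R by rewrite ltr0n fact_gt0.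
  set A := \sum_i _; apply/eqP; suff: n`!%:R * A == 0.
    by rewrite mulf_eq0 gt_eqF.
  apply/negPn/negP => A0; have /norm_intr_ge1/(_ A0) : n`!%:R * A \is a Num.int.
    rewrite mulr_sumr rpred_sum// => i _.
    by rewrite mulrCA rpredM ?intr_int ?indep_part_int.
  apply/negP; rewrite -ltNge.
  have -> : A = - \sum_i (z i)%:~R * (indep (r i) - indep_part (r i) n).
    under [in RHS]eq_bigr do rewrite mulrBr.
    by rewrite sumrB rel sub0r opprK.
  rewrite mulrN normrN normrM ger0_norm ?ler0n//.
  apply: (@le_lt_trans _ _ (n`!%:R * (M * (2 / n.+1`!%:R)))).
    rewrite ler_pM2l// mulr_suml; apply: le_trans (ler_norm_sum _ _ _) _.
    apply: ler_sum => i _; rewrite normrM ler_wpM2l//.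
    have /andP[? ?] := indep_bounds (r i) n.
    by rewrite ler_norml; apply/andP; split; lra.
  have -> : n`!%:R * (M * (2 / n.+1`!%:R)) = 2 * M / n.+1%:R.
    by rewrite factS natrM; field; rewrite gt_eqF ?ltr0n// gt_eqF.
  by rewrite ltr_pdivrMr ?ltr0n// mul1r -truncn_le_nat.
have [u [v uvE]] := isolating_rationals i0 r_inj.
(* The third component of the code makes it arbitrarily large, so some [k >= N] has digit 1 for
   [r i0] alone; the vanishing relations at [k] and [k.+1] then differ by [z i0 / k.+1!]. *)
have [|n Nn] := @injective_nat_unbounded (fun n => pickle (u, v, n)) N.
  by move=> n n' /(pcan_inj (@pickleK _)) [].
set k := pickle (u, v, n) in Nn.
have digitE i : digit (r i) k = (i == i0) by rewrite /digit pickleK uvE.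
have := part0 k.+1 (leqW Nn).
under eq_bigr do rewrite indep_partS mulrDr digitE.
rewrite big_split /= part0// add0r (bigD1 i0)//= eqxx big1 ?addr0; last first.
  by move=> i /negbTE ->; rewrite mul0r mulr0.
move/eqP; rewrite mul1r mulf_eq0 invr_eq0 pnatr_eq0 gtn_eqF ?fact_gt0// orbF.
by rewrite intr_eq0 => /eqP.
Qed.

Lemma indep_gt0 r : 0 < indep r.
Proof.
rewrite lt0r; apply/andP; split.
  have r_inj : injective (fun _ : 'I_1 => r) by move=> i j; rewrite !ord1.
  apply/eqP => r0; have := @indep_free 1 (fun=> r) (fun=> 1) r_inj.
  by rewrite big_ord1 r0 mulr0 => /(_ erefl ord0).
have /andP[+ _] := indep_bounds r 0; apply: le_trans.
by rewrite /indep_part big_ord0.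
Qed.

End independent_reals.

(** * The generators *)

Section exponential_generators.
Variables (R : realType) (V : R -> R).
Implicit Types (r : R).

Definition exp_gen r : unit_itv R -> R := fun x => expR (indep r * V (val x)).

Definition exponent n (r : 'I_n -> R) (m : multinom n) : R :=
  \sum_i (m i)%:R * indep (r i).

Definition expsum_of_mpoly n (r : 'I_n -> R) (P : mpoly n R) : seq (R * R) :=
  [seq (mcoeff m P, exponent r m) | m <- msupp P].

Lemma eval_mpoly_exp_gen n (r : 'I_n -> R) (P : mpoly n R) (x : unit_itv R) :
  @eval_mpoly R (unit_itv R -> R) n (fun i => exp_gen (r i)) P x =
  expsum (expsum_of_mpoly r P) (V (val x)).
Proof.
rewrite /eval_mpoly /mmap /expsum /expsum_of_mpoly [RHS]big_map.
rewrite (big_morph (fun f : unit_itv R -> R => f x) (id1 := 0) (op1 := +%R))//.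
apply: eq_bigr => m _.
have -> : (in_alg (unit_itv R -> R) (mcoeff m P) *
    mmap1 (fun i => exp_gen (r i)) m) x =
  mcoeff m P * (mmap1 (fun i => exp_gen (r i)) m x).
  by rewrite in_algE -scalerAl mul1r.
congr (_ * _); rewrite /mmap1.
rewrite (big_morph (fun f : unit_itv R -> R => f x) (id1 := 1) (op1 := *%R))//.
rewrite /exponent mulr_suml expR_sum; apply: eq_bigr => i _.
elim: (m i) => [|k IHk]; first by rewrite expr0 !mul0r expR0.
rewrite exprS -[LHS]/(exp_gen (r i) x * _) IHk /exp_gen -expRD; congr expR.
by rewrite -natr1; ring.
Qed.

(** A coincidence of exponents is an integer relation between the [indep (r i)], whose coefficients
    are the differences of the degrees. *)
Lemma exponent_inj n (r : 'I_n -> R) : injective r -> injective (exponent r).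
Proof.
move=> r_inj m m' mm'; apply/mnmP => i.
have := @indep_free R n r (fun i => (m i)%:Z - (m' i)%:Z) r_inj.
have -> : \sum_i ((m i)%:Z - (m' i)%:Z)%:~R * indep (r i) =
    exponent r m - exponent r m'.
  rewrite /exponent -sumrB; apply: eq_bigr => j _.
  by rewrite intrB mulrBl.
by rewrite mm' subrr => /(_ erefl i)/eqP; rewrite subr_eq0 eqz_nat => /eqP.
Qed.

Lemma exponent_gt0 n (r : 'I_n -> R) (m : multinom n) :
  m != mnm0 -> 0 < exponent r m.
Proof.
move=> m0; have [i mi] : exists i, m i != 0%N.
  apply: contrapT => /forallNP m_eq0; move/eqP: m0; apply; apply/mnmP => i.
  by rewrite mnm0E; apply/eqP/negPn/negP; exact: m_eq0.
rewrite /exponent (bigD1 i)//= ltr_wpDr ?mulr_gt0 ?indep_gt0 ?ltr0n ?lt0n//.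
by apply: sumr_ge0 => j _; rewrite mulr_ge0 // ltW ?indep_gt0.
Qed.

(** Only the constant monomial could give the exponent 0. *)
Lemma expsum_of_mpoly_gt0 n (r : 'I_n -> R) (P : mpoly n R) :
  no_constant_term P -> all (fun p => 0 < p.2) (expsum_of_mpoly r P).
Proof.
move=> P0; rewrite all_map; apply/allP => m mP /=; apply: exponent_gt0.
by apply: contraTneq mP => ->; rewrite mcoeff_msupp P0 eqxx.
Qed.

Lemma finite_zeros_expsum_of_mpoly n (r : 'I_n -> R) (P : mpoly n R) :
  injective r -> P != 0 ->
  finite_set [set t | expsum (expsum_of_mpoly r P) t = 0].
Proof.
move=> r_inj P0; apply: finite_zeros_expsum.
- by rewrite -size_eq0 size_map size_eq0 msupp_eq0.
- by rewrite all_map; apply/allP => m /=; rewrite mcoeff_msupp.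
- rewrite -map_comp map_inj_uniq ?msupp_uniq//; exact: exponent_inj.
Qed.

Lemma exp_gen_inj : (exists x : unit_itv R, V (val x) != 0) -> injective exp_gen.
Proof.
move=> [x Vx] r r' rr'.
have bb : indep r = indep r'.
  by apply: (mulIf Vx); apply: expR_inj; exact: (congr1 (fun f => f x) rr').
apply/eqP/negPn/negP => r_neq.
pose u (i : 'I_2) := if i == 0 then r else r'.
have u_inj : injective u.
  move=> i j; rewrite /u.
  have cases (k : 'I_2) : k = 0 \/ k = 1.
    by case: k => [[|[|//]] ?]; [left|right]; exact: val_inj.
  by have [->|->] := cases i; have [->|->] := cases j => //= E;
    move: r_neq; rewrite E eqxx.
have := @indep_free R 2 u (fun i => if i == 0 then 1 else -1) u_inj.
rewrite !big_ord_recl big_ord0 /= /u /= bb mul1r mulN1r addr0 subrr.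
by move=> /(_ erefl ord0).
Qed.

End exponential_generators.

(** The last condition reads [b^(1 - alpha) >= 3], so any even [b] above [3^(1 / (1 - alpha))]
    works. *)
Lemma lacunary_parameters (R : realType) (alpha : R) : 0 < alpha < 1 ->
  exists h : nat, [/\ (0 < h)%N, 0 < (2 * h)%:R `^ (- alpha),
    (2 * h)%:R `^ (- alpha) < 1 &
    3 <= (2 * h)%:R * (2 * h)%:R `^ (- alpha)].
Proof.
move=> /andP[alpha0 alpha1].
have a1 : 0 < 1 - alpha by rewrite subr_gt0.
pose x : R := 3 `^ (1 - alpha)^-1.
exists (Num.truncn x).+1; set b : R := _%:R.
have b1 : 1 < b by rewrite /b ltr1n mul2n.
have b0 : 0 < b by exact: lt_trans b1.
have xb : x <= b.
  apply: le_trans (ltW (truncnS_gt x)) _.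
  by rewrite /b ler_nat leq_pmull.
split => //; first by rewrite powR_gt0.
  by rewrite powRN invf_lt1 ?powR_gt0// one_lt_powR.
rewrite -{1}(powRr1 (ltW b0)) -powRD ?(gt_eqF b0) ?implybT//.
have -> : 3 = x `^ (1 - alpha) :> R by rewrite /x -powRrM mulVf ?powRr1// gt_eqF.
by apply: ge0_ler_powR; rewrite ?nnegrE ?powR_ge0 ?(ltW a1) ?(ltW b0).
Qed.

Theorem theorem4p8 (R : realType) (alpha : R) :
  0 < alpha < 1 ->
  strongly_algebrable [set: R]
    [set f : unit_itv R -> R |
      [/\ holder alpha f,
          has_box_dim (graph f) (2 - alpha) &
          exists E : set R,
            [/\ E `<=` `[0, 1]%classic,
                hausdorff_dim E = 0%E &
                forall x0 : unit_itv R, ~ E (val x0) ->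
                  holder_exponent f x0 = alpha%:E]]].
Proof.
move=> alpha01; have /andP[alpha0 alpha1] := alpha01.
have [h [h0 q0 q1 bq3]] := lacunary_parameters alpha01.
pose V := glued h ((2 * h)%:R `^ (- alpha)).
have avoids (Z : seq R) : exists2 x : unit_itv R, True & V (val x) \notin Z.
  have [x [x01 _ VZ]] := glued_avoids h0 q0 q1 bq3 true Z.
  by have [y yE] := unit_itv_val x01; exists y; rewrite ?yE.
have gen_inj : injective (exp_gen V).
  apply: exp_gen_inj; have [x _ Vx] := avoids [:: 0].
  by exists x; rewrite inE in Vx.
exists (range (exp_gen V)); split.
- by apply: inj_card_eq => r r' _ _; exact: gen_inj.
- move=> _ [n [x [P [xX P0 ->]]]].
  have /choice[r rx] i : exists ri, exp_gen V ri = x i.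
    by have [r _ rE] := xX i; exists r.
  have -> : x = fun i => exp_gen V (r i) by apply/funext => i; rewrite rx.
  have [s [nz pos us sE]] := expsum_normalize (expsum_of_mpoly_gt0 r P0).
  have evalE : @eval_mpoly R (unit_itv R -> R) n (fun i => exp_gen V (r i)) P =
      fun x => expsum s (V (val x)).
    by apply/funext => y; rewrite eval_mpoly_exp_gen sE.
  (* If everything cancels in the normalized sum, the element is 0; otherwise its critical points
     are finite in number. *)
  have [s0|s0] := eqVneq s [::].
    by right; rewrite /= evalE s0; apply/funext => y; rewrite expsum_nil.
  left; rewrite /= evalE; apply: composed_member => //.
  exact: finite_critical_points_expsum.
move=> n P x P0 x_inj xX.
have /choice[r rx] i : exists ri, exp_gen V ri = x i.
  by have [r _ rE] := xX i; exists r.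
have xE : x = fun i => exp_gen V (r i) by apply/funext => i; rewrite rx.
have r_inj : injective r by move=> i j rij; apply: x_inj; rewrite -!rx rij.
split=> [eval0|->]; last by rewrite /eval_mpoly mmap0.
(* For [P] nonzero the exponential sum has finitely many zeros, but [V] takes a value outside any
   finite set. *)
apply/eqP/negPn/negP => Pn0.
have /finite_seqP[Z ZE] := finite_zeros_expsum_of_mpoly r_inj Pn0.
have [y _ Vy] := avoids Z; move/negP: Vy; apply.
have : [set t | expsum (expsum_of_mpoly r P) t = 0] (V (val y)).
  by rewrite /= -eval_mpoly_exp_gen -xE eval0.
by rewrite ZE.
Qed.
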